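(* We have $$\mu_1(1+x+y)=\frac1\pi\,\mathrm{Ls}_2\!\left(\frac\pi3\right),\qquad \mu_2(1+x+y)=\frac3\pi\,\mathrm{Ls}_3\!\left(\frac{2\pi}3\right)+\frac{\pi^2}4 .$$
   Context: The higher Mahler measure is $\mu_n(1+x+y)=\int_0^1\int_0^1\left(\log\left|1+e^{2\pi i t}+e^{2\pi i u}\right|\right)^n dt\,du$. The log-sine integrals are $\mathrm{Ls}_{n}(\sigma)=-\int_0^\sigma \log^{n-1}\left|2\sin\frac\theta2\right|d\theta$. *)

(* Defs.v *)
From mathcomp Require Export all_boot all_order all_algebra.
From mathcomp Require Export complex.
From mathcomp Require Export all_classical all_reals all_analysis.

Set Implicit Arguments.
Unset Strict Implicit.
Unset Printing Implicit Defensive.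

Import Order.TTheory GRing.Theory Num.Theory.
Import numFieldNormedType.Exports.
Import ComplexField.Normc.

Local Open Scope classical_set_scope.
Local Open Scope ring_scope.
Local Open Scope complex_scope.

(* All integrals below are Lebesgue integrals with values in \bar R, so an
   equation with a finite value also asserts convergence.  The integrands
   have logarithmic singularities; since [ln 0 = 0], they are given a
   (harmless) finite value on a Lebesgue-null set. *)

(* [expi x] is $e^{ix}$ for real x. *)
Definition expi {R : realType} (x : R) : R[i] := cos x +i* sin x.

(* $\mu_n(P)$ for a function P of two complex variables. *)
Definition higher_mahler {R : realType} (n : nat) (P : R[i] -> R[i] -> R[i]) :
    \bar R :=
  (\int[lebesgue_measure]_(u in `[0%R, 1%R])
    \int[lebesgue_measure]_(t in `[0%R, 1%R])
      ((ln (normc (P (expi (2 * pi * t)) (expi (2 * pi * u))))) ^+ n)%:E)%E.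

(* $\int_a^b f$, oriented: the sign changes when b < a. *)
Definition oriented_integral {R : realType} (a b : R) (f : R -> \bar R) :
    \bar R :=
  (if (a <= b)%R then \int[lebesgue_measure]_(x in `[a, b]) f x
   else - \int[lebesgue_measure]_(x in `[b, a]) f x)%E.

(* $\mathrm{Ls}_n(\sigma)$, meaningful for n >= 1. *)
Definition Ls {R : realType} (n : nat) (sigma : R) : \bar R :=
  (- oriented_integral 0%R sigma
       (fun theta => ((ln `|2 * sin (theta / 2)|) ^+ n.-1)%:E))%E.

(* Main.v *)
(* Write 1 + y = a e^{i phi} with a = 2 cos phi. The Fourier expansion of
   log|1 - a e^{i theta}| for |a| < 1 shows that the mean over x of
   log|1 + x + y| is log^+|a| and, by Parseval, that the mean of its square is
   D(a) for |a| < 1 and log^2|a| + D(1/a) for |a| > 1, where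
   D(z) = Li_2(z^2) / 2.

   With w = 1/cos on [0, pi/3] and w = sin on [0, pi/6], both parts of the
   outer integral of D have the form of an integral of D(w(x)/w(b)) over
   0 < x < b. As a function of b it can be differentiated term by term, and the
   resulting logarithmic integrals are elementary in terms of
   S(x) = int_0^x log(2 sin t) dt and of the primitives of log^2(2 sin) and
   log(2 sin) log(2 cos). Letting b tend to pi/2 in the case w = 1/cos also
   yields int_0^{pi/2} log^2(2 sin t) dt = pi^3/24 from zeta(2) = pi^2/6. *)

Require Import Defs.
From mathcomp Require Import measurable_realfun ring lra.
Import Order.TTheory GRing.Theory Num.Theory.
Import numFieldNormedType.Exports.

Set Implicit Arguments.
Unset Strict Implicit.
Unset Printing Implicit Defensive.

Local Open Scope classical_set_scope.
Local Open Scope ring_scope.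

(** * Calculus *)

(** Most integrands are singular at an endpoint, and the integrals take extended real values.
    Integrands are therefore brought to a single sign, so that monotone convergence justifies both
    the fundamental theorem on open intervals and the exchange of sums and integrals; finiteness
    then mostly comes out of the computation instead of being assumed. Only the inner circle means
    use dominated convergence, for |a| < 1, and the excluded case |a| = 1 occurs for just two values
    of [u]. The end points are those where 2 cos(pi/3) = 1 and 2 sin(pi/6) = 1. Exactly there
    [lcos], respectively [lsin], vanishes, which removes every product with S from the second-moment
    formulas. What remains is a combination of the primitive Q of log^2(2 sin) at pi/6, pi/3, pi/2
    and 2 pi/3: reflection eliminates 2 pi/3, the values at pi/6 cancel, Q(pi/2) supplies part of
    the pi^2/4, and Q(pi/3) is a multiple of Ls_3(2 pi/3). *)

Section ftc.
Context {R : realType}.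
Local Notation mu := (@lebesgue_measure R).
Implicit Types (f F : R -> R) (a b x la lb d : R).

Lemma is_derive_continuous F x d : is_derive x 1 F d -> {for x, continuous F}.
Proof.
by move=> [dF _]; apply/differentiable_continuous/derivable1_diffP.
Qed.

(** Exhaust the open interval by compact ones, apply the usual theorem there and pass to the limit
    by monotone convergence. Nonnegativity of [f] takes the place of integrability near the
    endpoints, where [F] is known only through its one-sided limits. *)
Lemma ge0_FTC2_oo f F a b la lb : a < b ->
  (forall x, a < x < b -> is_derive x 1 F (f x)) ->
  (forall x, a < x < b -> {for x, continuous f}) ->
  (forall x, a < x < b -> 0 <= f x) ->
  F x @[x --> a^'+] --> la -> F x @[x --> b^'-] --> lb ->
  (\int[mu]_(x in `[a, b]) (f x)%:E = (lb - la)%:E)%E.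
Proof.
move=> ab dF cf f0 Fa Fb.
have mf : measurable_fun `]a, b[ f.
  apply: open_continuous_measurable_fun => //.
  by move=> x; rewrite inE/= in_itv/= => /cf.
have mEf : measurable_fun `]a, b[ (EFin \o f) by exact/measurable_EFinP.
rewrite (@integral_itv_bndoo _ a b (fun x => (f x)%:E) true false)//.
(* The factor 1/3 makes [a + d n < b - d n] hold already for n = 0. *)
pose d (n : nat) : R := (b - a) / 3 * (n.+1%:R)^-1.
have d0 n : 0 < d n by rewrite mulr_gt0// ?invr_gt0// divr_gt0// subr_gt0.
have dle n : d n <= (b - a) / 3.
  by rewrite ler_piMr ?divr_ge0 ?subr_ge0 ?(ltW ab)// invf_le1// ler1n.
have dnincr m n : (m <= n)%N -> d n <= d m.
  move=> mn; rewrite ler_wpM2l ?divr_ge0 ?subr_ge0 ?(ltW ab)//.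
  by rewrite lef_pV2 ?posrE// ler_nat.
have dcvg : d n @[n --> \oo] --> 0.
  rewrite -[X in _ --> X](mulr0 ((b - a) / 3)); apply: cvgM;
    first exact: cvg_cst.
  exact: cvg_harmonic.
pose E (n : nat) : set R := `[a + d n, b - d n]%classic.
have sE n : E n `<=` `]a, b[.
  move=> x; rewrite /E/= !in_itv/=. move=> /andP[h1 h2].
  by have d0n := d0 n; apply/andP; lra.
have UE : `]a, b[%classic = \bigcup_n E n.
  apply/seteqP; split => x; last by move=> [n _] /sE.
  rewrite /= in_itv/= => /andP[ax xb].
  have m0 : 0 < Num.min (x - a) (b - x) by rewrite lt_min !subr_gt0 ax.
  have /cvgrPdist_lt/(_ _ m0)[n _ /(_ n (leqnn _))] := dcvg.
  rewrite /= sub0r normrN gtr0_norm// lt_min => /andP[h1 h2].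
  by exists n => //; rewrite /E/= in_itv/=; apply/andP; lra.
have H : (\int[mu]_(x in E i) (f x)%:E)%E @[i --> \oo] -->
    (\int[mu]_(x in `]a, b[) (f x)%:E)%E.
  rewrite UE; apply: ge0_nondecreasing_set_cvg_integral.
  - apply/nondecreasing_seqP => n; rewrite subsetEset => x.
    rewrite /E/= !in_itv/= => /andP[h1 h2].
    by have dn := dnincr _ _ (leqnSn n); apply/andP; lra.
  - by move=> n; exact: measurable_itv.
  - by move=> n; apply: measurable_funS mEf => //; exact: sE.
  - by move=> n x /sE; rewrite /= in_itv/= => /f0; rewrite lee_fin.
have FE n : (\int[mu]_(x in E n) (f x)%:E)%E =
    (F (b - d n) - F (a + d n))%:E.
  have h : a + d n < b - d n by have h1 := dle n; have h2 := d0 n; lra.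
  have inab x : x \in `[a + d n, b - d n] -> a < x < b.
    by move=> /sE; rewrite /= in_itv.
  rewrite EFinB; apply: continuous_FTC2 => //.
  - apply: continuous_in_subspaceT => x; rewrite inE => /inab; exact: cf.
  - have cF x : x \in `[a + d n, b - d n] -> {for x, continuous F}.
      by move=> /inab/dF; exact: is_derive_continuous.
    split.
    + move=> x xi; have /dF[] // : a < x < b.
      by apply: inab; exact: subset_itv_oo_cc xi.
    + apply: cvg_at_right_filter; apply: cF.
      by rewrite in_itv/= lexx ltW.
    + apply: cvg_at_left_filter; apply: cF.
      by rewrite in_itv/= lexx ltW.
  - move=> x xi; rewrite derive1E; apply: derive_val.
    by apply: dF; apply: inab; exact: subset_itv_oo_cc xi.
suff H' : (F (b - d n) - F (a + d n))%:E @[n --> \oo] --> (lb - la)%:E.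
  move: H; rewrite (_ : (fun i => _) =
    (fun n => (F (b - d n) - F (a + d n))%:E)); last by apply/funext => n;
      exact: FE.
  by move=> H; exact: (cvg_unique _ H).
apply: cvg_EFin; first by apply: nearW.
apply: cvgB.
- move/cvg_at_leftP : Fb; apply; split; first by move=> n; have := d0 n; lra.
  rewrite -[X in _ --> X]subr0; apply: cvgB => //; exact: cvg_cst.
- move/cvg_at_rightP : Fa; apply; split; first by move=> n; have := d0 n; lra.
  rewrite -[X in _ --> X]addr0; apply: cvgD => //; exact: cvg_cst.
Qed.

(** The case of integrand 0. It turns an identity between derivatives into a functional equation for
    primitives whose endpoint values are only limits. *)
Lemma is_derive0_eq F a b la lb : a < b ->
  (forall x, a < x < b -> is_derive x 1 F 0) ->
  F x @[x --> a^'+] --> la -> F x @[x --> b^'-] --> lb -> la = lb.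
Proof.
move=> ab dF Fa Fb.
have : (\int[mu]_(x in `[a, b]) (cst 0 x)%:E = (lb - la)%:E)%E.
  by apply: (@ge0_FTC2_oo (cst 0) F) => // x _; exact: cvg_cst.
rewrite (_ : (\int[mu]_(x in _) _)%E = 0%E); last exact: integral0.
by case=> /eqP; rewrite eq_sym subr_eq0 eq_sym => /eqP.
Qed.

End ftc.

(** * Affine change of variables for Lebesgue measure *)

Section affine.
Context {R : realType}.
Local Notation mu := (@lebesgue_measure R).

Lemma affine_itv_neg (a b c d x : R) : c < 0 ->
  (a < c * x + d <= b) = ((b - d) / c <= x < (a - d) / c).
Proof.
by move=> c0; rewrite ler_ndivrMr// ltr_ndivlMr// andbC lerBrDr ltrBlDr mulrC.
Qed.

Lemma affine_itv_pos (a b c d x : R) : 0 < c ->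
  (a < c * x + d <= b) = ((a - d) / c < x <= (b - d) / c).
Proof.
by move=> c0; rewrite ltr_pdivrMr// ler_pdivlMr// lerBrDr ltrBlDr mulrC.
Qed.

(** By uniqueness of Lebesgue measure it suffices to compare on intervals []a, b]]. Negative slopes
    are included for the sake of the reflections [pi - x] and [pi / 2 - x]; they turn the preimage
    into an interval closed on the other side, of the same length. *)
Lemma lebesgue_measure_affine (c d : R) (A : set R) : c != 0 -> measurable A ->
  (`|c|%:E * pushforward mu (fun x : measurableTypeR R =>
    (c * x + d)%R : measurableTypeR R) A = mu A)%E.
Proof.
move=> c0 mA.
pose phi := (fun x : measurableTypeR R => (c * x + d)%R : measurableTypeR R).
have mphi : measurable_fun setT phi by apply: measurable_funD => //;
  apply: measurable_funM.
pose nu0 : {measure set (measurableTypeR R) -> \bar R} :=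
  mscale (NngNum (normr_ge0 c)) (pushforward mu phi).
pose nu := nu0 mphi.
rewrite -[LHS]/(nu A); apply/esym/lebesgue_measure_unique => //= _ [[a b]] _ <-.
rewrite -[RHS]/(`|c|%:E * mu (phi @^-1` _))%E.
have [c1|c1|] := ltgtP c 0; last by move/eqP; rewrite (negbTE c0).
- rewrite (_ : phi @^-1` _ = `[(b - d) / c, (a - d) / c[%classic); last first.
    by apply/funext => x; rewrite /phi/= !in_itv/= affine_itv_neg.
  rewrite !lebesgue_measure_itv/= !lte_fin ltr_ndivrMr// divfK// ltrD2r.
  case: ifPn => ab; last by rewrite mule0.
  by rewrite -!EFinB -EFinM ltr0_norm//; congr (_%:E); field.
- rewrite (_ : phi @^-1` _ = `](a - d) / c, (b - d) / c]%classic); last first.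
    by apply/funext => x; rewrite /phi/= !in_itv/= affine_itv_pos.
  rewrite !lebesgue_measure_itv/= !lte_fin ltr_pdivrMr// divfK ?gt_eqF// ltrD2r.
  case: ifPn => ab; last by rewrite mule0.
  by rewrite -!EFinB -EFinM gtr0_norm//; congr (_%:E); field.
Qed.

(** Only measurability and nonnegativity are asked of [f], because it is later an
    extended-real-valued series such as [mean2]. *)
Lemma ge0_integral_affine (c d : R) (D : set R) (f : R -> \bar R) :
  c != 0 -> measurable D -> measurable_fun setT f -> (forall x, 0 <= f x)%E ->
  (\int[mu]_(x in D) f x =
   `|c|%:E * \int[mu]_(x in (fun x => (c * x + d)%R) @^-1` D) f (c * x +
     d)%R)%E.
Proof.
move=> c0 mD mf f0.
pose phi := (fun x : measurableTypeR R => (c * x + d)%R : measurableTypeR R).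
have mphi : measurable_fun setT phi by apply: measurable_funD => //;
  apply: measurable_funM.
rewrite -(@ge0_integral_pushforward _ _ _ _ R phi mphi mu D f)//; last first.
  exact: measurable_funS mf.
pose nu0 : {measure set (measurableTypeR R) -> \bar R} :=
  mscale (NngNum (normr_ge0 c)) (pushforward mu phi).
pose nu := nu0 mphi.
transitivity (\int[nu]_(x in D) f x)%E.
  apply: eq_measure_integral => A mA _; exact/esym/lebesgue_measure_affine.
by rewrite ge0_integral_mscale//; apply: measurable_funS mf.
Qed.

End affine.

(** * Derivatives of explicit expressions *)

Section derive_rules.
Context {R : realType}.
Implicit Types (f g : R -> R) (x a b df dg : R).

Lemma der_cst x a : is_derive x 1 (fun=> a) 0.
Proof. exact: is_derive_cst. Qed.

Lemma der_id x : is_derive x 1 (fun y => y) 1.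
Proof. exact: is_derive_id. Qed.

Lemma derD f g x df dg : is_derive x 1 f df -> is_derive x 1 g dg ->
  is_derive x 1 (fun y => f y + g y) (df + dg).
Proof. by move=> hf hg; exact: is_deriveD. Qed.

Lemma derN f x df : is_derive x 1 f df -> is_derive x 1 (fun y => - f y) (- df).
Proof. by move=> hf; exact: is_deriveN. Qed.

Lemma derB f g x df dg : is_derive x 1 f df -> is_derive x 1 g dg ->
  is_derive x 1 (fun y => f y - g y) (df - dg).
Proof. by move=> hf hg; exact: is_deriveB. Qed.

Lemma derM f g x df dg : is_derive x 1 f df -> is_derive x 1 g dg ->
  is_derive x 1 (fun y => f y * g y) (df * g x + f x * dg).
Proof.
by move=> hf hg; apply: is_derive_eq; rewrite addrC mulrC.
Qed.

Lemma derX f x n df : is_derive x 1 f df ->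
  is_derive x 1 (fun y => f y ^+ n) (n%:R * f x ^+ n.-1 * df).
Proof.
move=> hf; rewrite (_ : (fun y => f y ^+ n) = f ^+ n); first exact: is_deriveX.
by apply/funext => y; rewrite exprfctE.
Qed.

Lemma derV f x df : f x != 0 -> is_derive x 1 f df ->
  is_derive x 1 (fun y => (f y)^-1) (- (f x) ^- 2 * df).
Proof. exact: is_deriveV. Qed.

Lemma derL f g x d : is_derive (g x) 1 f d -> forall dg, is_derive x 1 g dg ->
  is_derive x 1 (fun y => f (g y)) (d * dg).
Proof. by move=> hf dg hg; exact: is_derive1_comp. Qed.

Lemma der_sin g x dg : is_derive x 1 g dg ->
  is_derive x 1 (fun y => sin (g y)) (cos (g x) * dg).
Proof. by apply: (@derL sin); exact: is_derive_sin. Qed.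

Lemma der_cos g x dg : is_derive x 1 g dg ->
  is_derive x 1 (fun y => cos (g y)) (- sin (g x) * dg).
Proof. by apply: (@derL cos); exact: is_derive_cos. Qed.

Lemma der_ln g x dg : 0 < g x -> is_derive x 1 g dg ->
  is_derive x 1 (fun y => ln (g y)) ((g x)^-1 * dg).
Proof. by move=> g0; apply: (@derL (@ln R)); exact: is_derive1_ln. Qed.

Lemma der_eq f x a b : is_derive x 1 f a -> a = b -> is_derive x 1 f b.
Proof. by move=> ? <-. Qed.

End derive_rules.

(** The rules are matched on the syntactic shape of the function; [eassumption] supplies derivatives
    from the context for functions like [Slog]. Positivity and nonvanishing conditions are left as
    side goals, and [der] ends with the equality between the computed and the expected
    derivative. *)
Ltac der_step := match goal with
  | |- is_derive _ _ (fun=> ?a) _ => exact: der_cst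
  | |- is_derive _ _ (fun y => y) _ => exact: der_id
  | |- is_derive _ _ (fun y => @?f y + @?g y) _ =>
    notypeclasses refine (@derD _ f g _ _ _ _ _)
  | |- is_derive _ _ (fun y => - @?f y) _ => notypeclasses refine (@derN _ f _ _
    _)
  | |- is_derive _ _ (fun y => @?f y * @?g y) _ =>
    notypeclasses refine (@derM _ f g _ _ _ _ _)
  | |- is_derive _ _ (fun y => @?f y ^+ ?n) _ =>
    notypeclasses refine (@derX _ f _ _ _ _)
  | |- is_derive _ _ (fun y => (@?f y)^-1) _ =>
    notypeclasses refine (@derV _ f _ _ _ _)
  | |- is_derive _ _ (fun y => sin (@?f y)) _ =>
    notypeclasses refine (@der_sin _ f _ _ _)
  | |- is_derive _ _ (fun y => cos (@?f y)) _ =>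
    notypeclasses refine (@der_cos _ f _ _ _)
  | |- is_derive _ _ (fun y => ln (@?f y)) _ =>
    notypeclasses refine (@der_ln _ f _ _ _ _)
  | |- is_derive _ _ _ _ => eassumption
  end.
Ltac der := notypeclasses refine (der_eq _ _); [repeat (der_step;
  cbv beta)|cbv beta].

(** * Powers of the logarithm against y at 0 *)

Section xlnx.
Context {R : realType}.

(** With z the fourth root of y, ln y = 4 ln z and y ln^2 y = 16 z^2 (z ln z)^2, where |z ln z| <= 1
    because ln(1/z) < 1/z. *)
Lemma mul_sqr_ln_le (y : R) : 0 < y <= 1 ->
  y * ln y ^+ 2 <= 16 * Num.sqrt y.
Proof.
move=> /andP[y0 y1]; pose z := Num.sqrt (Num.sqrt y).
have z0 : 0 < z by rewrite !sqrtr_gt0.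
have z2 : z ^+ 2 = Num.sqrt y by rewrite sqr_sqrtr// sqrtr_ge0.
have z4 : z ^+ 4 = y by rewrite (exprM z 2 2) z2 sqr_sqrtr// ltW.
have -> : ln y = 4 * ln z by rewrite -z4 lnXn// mulr_natl.
have z1 : z <= 1.
  by rewrite -(@ler_pXn2r _ 4%N)// ?nnegrE ?(ltW z0)// z4 expr1n.
have lnz0 : ln z <= 0 by exact: ln_le0.
have lnz : - (ln z * z) <= 1.
  have : ln z^-1 < z^-1 by apply: ln_sublinear; rewrite invr_gt0.
  by rewrite lnV ?posrE// -(ltr_pM2r z0) mulVf ?gt_eqF// mulNr => /ltW.
have h : 0 <= - (ln z * z) by rewrite -mulNr mulr_ge0 ?oppr_ge0// ltW.
rewrite -z2 -{1}z4 (_ : z ^+ 4 * (4 * ln z) ^+ 2 = 16 * z ^+ 2 * (- (ln z * z))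
  ^+ 2).
  by apply: ler_piMr; [rewrite mulr_ge0 ?sqr_ge0|rewrite expr_le1].
by ring.
Qed.

Lemma mul_sqr_ln_cvg0 : y * ln y ^+ 2 @[y --> (0:R)^'+] --> (0 : R).
Proof.
apply: (@squeeze_cvgr _ _ _ _ (cst 0) (fun y => 16 * Num.sqrt y)).
- near=> y.
  have y0 : 0 < y by near: y; exact: nbhs_right_gt.
  have y1 : y <= 1 by near: y; exact: nbhs_right_le.
  apply/andP; split; first by rewrite mulr_ge0 ?sqr_ge0 ?(ltW y0).
  by apply: mul_sqr_ln_le; rewrite y0.
- exact: cvg_cst.
- rewrite -[X in _ --> X](mulr0 16) -[X in _ * X](@sqrtr0 R).
  apply: cvgM; first exact: cvg_cst.
  by apply: cvg_at_right_filter; exact: sqrt_continuous.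
Unshelve. all: by end_near. Qed.

(** Reduced to the squared logarithm by |ln y| <= 1 + ln^2 y. *)
Lemma mul_ln_cvg0 : y * ln y @[y --> (0:R)^'+] --> (0 : R).
Proof.
have yr : y @[y --> (0:R)^'+] --> (0:R) by apply: cvg_at_right_filter;
  exact: cvg_id.
have h : y + y * ln y ^+ 2 @[y --> (0:R)^'+] --> (0 : R).
  by rewrite -[X in _ --> X]addr0; apply: cvgD => //; exact: mul_sqr_ln_cvg0.
apply: (@squeeze_cvgr _ _ _ _ (fun y => - (y + y * ln y ^+ 2)) (fun y =>
  y + y * ln y ^+ 2)).
- near=> y; have y0 : 0 < y by near: y; exact: nbhs_right_gt.
  rewrite -ler_norml normrM gtr0_norm// -[X in X + _]mulr1 -mulrDr ler_pM2l//.
  by rewrite -normr_id; set u := `|_|; have := sqr_ge0 (`|ln y| - 1);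
    rewrite -(real_normK (num_real (ln y))) /u normr_id;
    have := normr_ge0 (ln y); nra.
- by rewrite -[X in _ --> X]oppr0; exact: cvgN.
- exact: h.
Unshelve. all: by end_near. Qed.

End xlnx.

(** * The logarithmic sine and its primitives *)

Section itv_split.
Context {R : realType}.
Local Notation mu := (@lebesgue_measure R).

Lemma ge0_integral_itv_split (a c b : R) (f : R -> \bar R) : a <= c <= b ->
  measurable_fun setT f -> (forall x, 0 <= f x)%E ->
  (\int[mu]_(x in `[a, b]) f x =
   \int[mu]_(x in `[a, c]) f x + \int[mu]_(x in `[c, b]) f x)%E.
Proof.
move=> /andP[ac cb] mf f0.
rewrite (@itv_bndbnd_setU _ _ (BLeft a) (BRight c) (BRight b)) ?bnd_simp//.
rewrite ge0_integral_setU//=; last 2 first.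
- exact: measurable_funS mf.
- apply/disj_set2P; rewrite -subset0 => z/=; rewrite !in_itv/= => -[/andP[_]].
  by rewrite leNgt => /negbTE ->.
congr (_ + _)%E; apply: integral_itv_obnd_cbnd.
exact: measurable_funS mf.
Qed.

End itv_split.

Section logsine.
Context {R : realType}.
Local Notation mu := (@lebesgue_measure R).
Implicit Types x t : R.

(** The absolute value of the log-sine integrand disappears because the relevant arguments lie in
    [0, pi] for [lsin] and in [0, pi/2] for [lcos]. *)
Definition lsin x := ln (2 * sin x).
Definition lcos x := ln (2 * cos x).

Lemma pihalf_gt0 : 0 < pi / 2 :> R. Proof. by rewrite divr_gt0 ?pi_gt0. Qed.

Lemma sin_piB x : sin (pi - x) = sin x.
Proof. by rewrite sinB sinpi cospi; ring. Qed.

Lemma sin_pihalfB x : sin (pi / 2 - x) = cos x.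
Proof. by rewrite sinB sin_pihalf cos_pihalf; ring. Qed.

Lemma cos_pihalfB x : cos (pi / 2 - x) = sin x.
Proof. by rewrite cosB sin_pihalf cos_pihalf; ring. Qed.

Lemma sin_double x : sin (2 * x) = 2 * sin x * cos x.
Proof. by rewrite mulr_natl sin_mulr2n mulr2n; ring. Qed.

Lemma lsin_piB x : lsin (pi - x) = lsin x.
Proof. by rewrite /lsin sin_piB. Qed.

Lemma lsin_pihalfB x : lsin (pi / 2 - x) = lcos x.
Proof. by rewrite /lsin sin_pihalfB. Qed.

Lemma cos_gt0_oo x : 0 < x < pi / 2 -> 0 < cos x.
Proof. by move=> /andP[x0 x1]; apply: cos_gt0_pihalf; apply/andP;
  have := pi_gt0 R; lra. Qed.

Lemma lsin_double x : 0 < x < pi / 2 -> lsin (2 * x) = lsin x + lcos x.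
Proof.
move=> xi; have c0 := cos_gt0_oo xi.
have s0 : 0 < sin x by apply: sin_gt0_pi; move: xi => /andP[? ?]; apply/andP;
  lra.
by rewrite /lsin /lcos -lnM ?posrE ?mulr_gt0// sin_double; congr ln; ring.
Qed.

Lemma der_lsin x : 0 < x < pi -> is_derive x 1 lsin (cos x / sin x).
Proof.
move=> /sin_gt0_pi s0; rewrite /lsin; der; first by rewrite mulr_gt0.
by field; rewrite gt_eqF.
Qed.

Lemma der_lcos x : 0 < x < pi / 2 -> is_derive x 1 lcos (- (sin x / cos x)).
Proof.
move=> /cos_gt0_oo s0; rewrite /lcos; der; first by rewrite mulr_gt0.
by field; rewrite gt_eqF.
Qed.

Lemma measurable_lsin : measurable_fun setT lsin.
Proof.
apply: measurableT_comp; first exact: measurable_ln.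
apply: measurable_funM => //; apply: continuous_measurable_fun.
exact: continuous_sin.
Qed.

(** The limit is taken in the filter [0^'+] so that it composes with the one-sided limits of y ln y
    and y ln^2 y. *)
Lemma sin_cvg_right0 : 2 * sin x @[x --> (0 : R)^'+] --> (0 : R)^'+.
Proof.
have c : 2 * sin x @[x --> (0 : R)^'+] --> (0 : R).
  rewrite -[X in _ --> X](mulr0 2) -[X in _ * X]sin0.
  apply: cvgM; first exact: cvg_cst.
  by apply: cvg_at_right_filter; exact: continuous_sin.
move=> A [e e0 He]; have /cvgrPdist_lt/(_ _ e0) := c.
move=> h; suff : \forall x \near (0 : R)^'+, A (2 * sin x) by [].
near=> x; apply: He => /=; first by near: x.
rewrite mulr_gt0// sin_gt0_pi//; apply/andP; split; near: x.
  exact: nbhs_right_gt.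
by apply: nbhs_right_lt; exact: pi_gt0.
Unshelve. all: by end_near. Qed.

(** The weight 2 cos x makes the square of [lsin] exactly integrable by the substitution y = 2 sin
    x. The weighted function [h] then dominates: the square of [lsin] is at most [h + 1] on the
    whole interval. *)
Lemma lsin2_half_lty : (\int[mu]_(x in `[0%R,
  (pi / 2)%R]) (lsin x ^+ 2)%:E < +oo)%E.
Proof.
have mls : measurable_fun setT (fun x => lsin x ^+ 2).
  by apply: measurable_funX; exact: measurable_lsin.
have mcos : measurable_fun setT (fun x : R => 2 * cos x).
  by apply: measurable_funM => //; apply: continuous_measurable_fun;
    exact: continuous_cos.
pose h x := (2 * cos x) * lsin x ^+ 2.
have h0 x : 0 < x < pi / 2 -> 0 <= h x.
  by move=> /cos_gt0_oo c; rewrite mulr_ge0 ?sqr_ge0// mulr_ge0// ltW.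
have hint : exists l : R, (\int[mu]_(x in `[0%R,
  (pi / 2)%R]) (h x)%:E = l%:E)%E.
  (* The primitive y ln^2 y - 2 y ln y + 2 y of ln^2 y, taken at y = 2 sin x. *)
  pose F x := (2 * sin x) * lsin x ^+ 2 - 2 * ((2 * sin x) * lsin x) + 2 * (2 *
    sin x).
  have dF x : 0 < x < pi -> is_derive x 1 F (h x).
    move=> xi; have s0 := sin_gt0_pi xi; have dl := der_lsin xi.
    by rewrite /F; der; rewrite /h; field; rewrite gt_eqF.
  have xpi x : 0 < x < pi / 2 -> 0 < x < pi.
    by move=> /andP[? ?]; apply/andP; lra.
  exists (F (pi / 2) - 0); apply: (@ge0_FTC2_oo _ h F) => //.
  - exact: pihalf_gt0.
  - by move=> x /xpi; exact: dF.
  - move=> x /xpi xi; have s0 := sin_gt0_pi xi; have dl := der_lsin xi.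
    have dh : is_derive x 1 h (2 * - sin x * lsin x ^+ 2 + 2 * cos x * (2 * lsin
      x * (cos x / sin x))).
      by rewrite /h; der; ring.
    exact: is_derive_continuous dh.
  - rewrite -[X in _ --> X](_ : 0 - 2 * 0 + 2 * 0 = 0); last by ring.
    apply: cvgD; last first.
      apply: cvgM; first exact: cvg_cst.
      apply: cvg_trans sin_cvg_right0 _; exact: cvg_within.
    apply: cvgB; first exact: (cvg_comp _ _ sin_cvg_right0 mul_sqr_ln_cvg0).
    apply: cvgM; first exact: cvg_cst.
    exact: (cvg_comp _ _ sin_cvg_right0 mul_ln_cvg0).
  - apply: cvg_at_left_filter; apply: is_derive_continuous; apply: dF.
    by have := pi_gt0 R => p; apply/andP; lra.
have [l hl] := hint.
have mh : measurable_fun setT h by exact: measurable_funM.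
have mE (f : R -> R) : measurable_fun setT f ->
    measurable_fun `]0%R, (pi / 2 : R)[ (EFin \o f).
  by move=> mf; apply/measurable_EFinP; exact: measurable_funS mf.
rewrite (@integral_itv_bndoo _ 0 (pi / 2) (fun x =>
  (lsin x ^+ 2)%:E) true false); last exact: mE.
move: hl; rewrite (@integral_itv_bndoo _ 0 (pi / 2) (fun x =>
  (h x)%:E) true false); last exact: mE.
move=> hl.
have h0E x : x \in `]0, (pi / 2)[ -> (0 <= (h x)%:E)%E.
  by rewrite in_itv/= lee_fin; exact: h0.
apply: (@le_lt_trans _ _ (\int[mu]_(x in `]0%R,
  (pi / 2)%R[) ((h x)%:E + 1%:E))%E).
  apply: ge0_le_integral => //.
  - by move=> x _; rewrite lee_fin sqr_ge0.
  - exact: mE.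
  - apply: emeasurable_funD => //; exact: mE.
  - move=> x /=; rewrite in_itv/= => xi.
    have c0 := cos_gt0_oo xi.
    have s0 : 0 < sin x by apply: sin_gt0_pi; move: xi => /andP[? ?];
      apply/andP; lra.
    rewrite -EFinD lee_fin /h; have cs := cos2Dsin2 x.
    (* If cos x >= 1/2 the weight is at least 1. Otherwise sin x >= 1/2, so 1 <= 2 sin x <= 2 and
       the logarithm lies between 0 and 1. *)
    have [c1|c1] := leP (1 / 2) (cos x).
      by have := sqr_ge0 (lsin x); nra.
    have s1 : 1 / 2 <= sin x by nra.
    have l0 : 0 <= lsin x by apply: ln_ge0; lra.
    have l1 : lsin x <= 1.
      have := @le_ln1Dx R (2 * sin x - 1); rewrite (_ : 1 + (2 * sin x - 1) = 2
        * sin x); last by ring.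
      by have := sin_le1 x; rewrite -/(lsin x); lra.
    have : 0 <= 2 * cos x * lsin x ^+ 2 by rewrite mulr_ge0 ?sqr_ge0//
      mulr_ge0// ltW.
    by nra.
rewrite ge0_integralD//; last exact: mE.
rewrite hl integral_cst//= mul1e lebesgue_measure_itv/=.
by case: ifPn => _; rewrite ltry.
Qed.

Lemma lsin2_lty : (\int[mu]_(x in `[0%R, pi]) (lsin x ^+ 2)%:E < +oo)%E.
Proof.
have mls : measurable_fun setT (fun x => (lsin x ^+ 2)%:E).
  by apply/measurable_EFinP; apply: measurable_funX; exact: measurable_lsin.
rewrite (@ge0_integral_itv_split _ _ (pi / 2))//; last 2 first.
- by have := pi_gt0 R => p; apply/andP; lra.
- by move=> x; rewrite lee_fin sqr_ge0.
rewrite lte_add_pinfty ?lsin2_half_lty//.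
rewrite (@ge0_integral_affine _ (-1) pi) ?oppr_eq0//; last first.
  by move=> x; rewrite lee_fin sqr_ge0.
rewrite normrN1 mul1e (_ : _ @^-1` _ = `[0, pi / 2]%classic); last first.
  by apply/funext => x; rewrite /= !in_itv/=; apply/propext;
    split => /andP[? ?]; apply/andP; lra.
rewrite (_ : (\int[mu]_(x in _) _)%E = (\int[mu]_(x in `[0%R,
  (pi / 2)%R]) (lsin x ^+ 2)%:E)%E).
  exact: lsin2_half_lty.
by apply: eq_integral => x _; rewrite -(lsin_piB x) mulN1r addrC.
Qed.

Lemma integrable_lsin2 : mu.-integrable `[0, pi] (EFin \o (fun x =>
  lsin x ^+ 2)).
Proof.
apply/integrableP; split.
  apply/measurable_EFinP; apply: measurable_funX.
  exact: measurable_funS measurable_lsin.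
by under eq_integral do rewrite /= normrX -normrX ger0_norm ?sqr_ge0//;
  exact: lsin2_lty.
Qed.

(** Square integrability suffices on a bounded interval, by |l| <= 1 + l^2. *)
Lemma integrable_lsin : mu.-integrable `[0, pi] (EFin \o lsin).
Proof.
apply: (@le_integrable _ _ _ mu _ _ _ (EFin \o (fun x => 1 + lsin x ^+ 2))) =>
  //.
- by apply/measurable_EFinP; exact: measurable_funS measurable_lsin.
- move=> x _ /=; rewrite lee_fin [leRHS]ger0_norm ?addr_ge0 ?sqr_ge0//.
  rewrite -(real_normK (num_real (lsin x))).
  by have := sqr_ge0 (`|lsin x| - 1); have := normr_ge0 (lsin x); nra.
- rewrite (_ : _ \o _ = (fun x => 1%:E + (lsin x ^+ 2)%:E)%E)//.
  apply: integrableD => //; last exact: integrable_lsin2.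
  apply: (@continuous_compact_integrable R (cst 1));
    first exact: segment_compact.
  by apply: continuous_subspaceT => x; exact: cst_continuous.
Qed.

(** For 0 <= x <= pi, -2 S(x) is Ls_2(2x), the Clausen function Cl_2(2x), and -2 Q(x) for the next
    definition is Ls_3(2x). *)
Definition Slog x := (\int[mu]_(t in `[0, x]) lsin t)%R.
Definition Qlog x := (\int[mu]_(t in `[0, x]) (lsin t ^+ 2))%R.

Lemma continuous_lsin x : 0 < x < pi -> {for x, continuous lsin}.
Proof. by move=> /der_lsin; exact: is_derive_continuous. Qed.

Lemma continuous_lsin2 x : 0 < x < pi -> {for x, continuous (fun t =>
  lsin t ^+ 2)}.
Proof.
move=> xi; have dl := der_lsin xi.
have : is_derive x 1 (fun t => lsin t ^+ 2) (2 * lsin x * (cos x / sin x)) by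
  der.
exact: is_derive_continuous.
Qed.

Lemma der_Slog x : 0 < x < pi -> is_derive x 1 Slog (lsin x).
Proof.
move=> /andP[x0 xpi].
have [d1 d2] := continuous_FTC1_closed xpi integrable_lsin x0
  (continuous_lsin (introT andP (conj x0 xpi))).
by apply: DeriveDef; [exact: d1|rewrite -derive1E].
Qed.

Lemma der_Qlog x : 0 < x < pi -> is_derive x 1 Qlog (lsin x ^+ 2).
Proof.
move=> /andP[x0 xpi].
have [d1 d2] := continuous_FTC1_closed xpi integrable_lsin2 x0
  (continuous_lsin2 (introT andP (conj x0 xpi))).
by apply: DeriveDef; [exact: d1|rewrite -derive1E].
Qed.

Lemma Slog_cvg0 : Slog x @[x --> (0 : R)^'+] --> 0.
Proof.
apply: cvg_at_right_filter.
exact: (parameterized_integral_cvg_left (pi_gt0 R) integrable_lsin).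
Qed.
End logsine.

(** * One-sided limits along affine maps *)

Section cvg_side.
Context {R : realType}.
Implicit Types (a b c d la lb x : R) (f h F : R -> R).

(** Landing in [b^'+], and not merely near [b], is what allows composition with limits known from
    one side only, such as those of S and Q at 0. *)
Lemma cvg_to_right (T : Type) (G : set_system T) (FG : Filter G) (h : T ->
  R) b :
  h x @[x --> G] --> b -> (\forall x \near G, b < h x) ->
    h x @[x --> G] --> b^'+.
Proof.
move=> hb bh A [e e0 He]; have /cvgrPdist_lt/(_ _ e0) h1 := hb.
suff : \forall x \near G, A (h x) by [].
by near=> x; apply: He => /=; near: x.
Unshelve. all: by end_near. Qed.

Lemma cvg_to_left (T : Type) (G : set_system T) (FG : Filter G) (h : T -> R) b :
  h x @[x --> G] --> b -> (\forall x \near G, h x < b) ->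
    h x @[x --> G] --> b^'-.
Proof.
move=> hb bh A [e e0 He]; have /cvgrPdist_lt/(_ _ e0) h1 := hb.
suff : \forall x \near G, A (h x) by [].
by near=> x; apply: He => /=; near: x.
Unshelve. all: by end_near. Qed.

Lemma affine_continuous c d a : (c * x + d) @[x --> a] --> c * a + d.
Proof.
by apply: cvgD; [apply: cvgM; [exact: cvg_cst|exact: cvg_id]|exact: cvg_cst].
Qed.

Lemma affine_right_right c d a b : 0 < c -> c * a + d = b ->
  (c * x + d) @[x --> a^'+] --> b^'+.
Proof.
move=> c0 <-; apply: cvg_to_right.
  apply: cvg_at_right_filter; exact: affine_continuous.
by near=> x; rewrite ltrD2r ltr_pM2l//; near: x; exact: nbhs_right_gt.
Unshelve. all: by end_near. Qed.

Lemma affine_left_left c d a b : 0 < c -> c * a + d = b ->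
  (c * x + d) @[x --> a^'-] --> b^'-.
Proof.
move=> c0 <-; apply: cvg_to_left.
  apply: cvg_at_left_filter; exact: affine_continuous.
by near=> x; rewrite ltrD2r ltr_pM2l//; near: x; exact: nbhs_left_lt.
Unshelve. all: by end_near. Qed.

Lemma affine_right_left c d a b : c < 0 -> c * a + d = b ->
  (c * x + d) @[x --> a^'+] --> b^'-.
Proof.
move=> c0 <-; apply: cvg_to_left.
  apply: cvg_at_right_filter; exact: affine_continuous.
by near=> x; rewrite ltrD2r ltr_nM2l//; near: x; exact: nbhs_right_gt.
Unshelve. all: by end_near. Qed.

Lemma affine_left_right c d a b : c < 0 -> c * a + d = b ->
  (c * x + d) @[x --> a^'-] --> b^'+.
Proof.
move=> c0 <-; apply: cvg_to_right.
  apply: cvg_at_left_filter; exact: affine_continuous.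
by near=> x; rewrite ltrD2r ltr_nM2l//; near: x; exact: nbhs_left_lt.
Unshelve. all: by end_near. Qed.

Lemma is_derive_cvg_right F x d : is_derive x 1 F d ->
  F y @[y --> x^'+] --> F x.
Proof. by move=> dF; apply: cvg_at_right_filter;
  exact: is_derive_continuous dF. Qed.

Lemma is_derive_cvg_left F x d : is_derive x 1 F d -> F y @[y --> x^'-] --> F x.
Proof. by move=> dF; apply: cvg_at_left_filter;
  exact: is_derive_continuous dF. Qed.

(** The difference of the two limits is the integral of a nonnegative function. *)
Lemma ge0_is_derive_le f F a b la lb : a < b ->
  (forall x, a < x < b -> is_derive x 1 F (f x)) ->
  (forall x, a < x < b -> {for x, continuous f}) ->
  (forall x, a < x < b -> 0 <= f x) ->
  F x @[x --> a^'+] --> la -> F x @[x --> b^'-] --> lb -> la <= lb.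
Proof.
move=> ab dF cf f0 Fa Fb; rewrite -subr_ge0 -lee_fin -(ge0_FTC2_oo ab dF cf f0
  Fa Fb).
rewrite -[leLHS]/0%E.
rewrite (@integral_itv_bndoo _ a b (fun x => (f x)%:E) true false).
  by apply: integral_ge0 => x /=; rewrite in_itv/= lee_fin; exact: f0.
apply/measurable_EFinP; apply: open_continuous_measurable_fun => //.
by move=> x; rewrite inE/= in_itv/=; exact: cf.
Qed.

End cvg_side.

(** * Reflection and duplication for the primitives S and Q *)

Section logsine_values.
Context {R : realType}.
Local Notation S := (@Slog R).
Local Notation Q := (@Qlog R).
Implicit Types x t b : R.

Lemma Qlog_cvg0 : Q x @[x --> (0 : R)^'+] --> 0.
Proof.
apply: cvg_at_right_filter.
exact: (parameterized_integral_cvg_left (pi_gt0 R) integrable_lsin2).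
Qed.

Lemma Slog_cvgpi : S x @[x --> (pi : R)^'-] --> S pi.
Proof. exact: (parameterized_integral_cvg_at_left (pi_gt0 R) integrable_lsin).
  Qed.

Lemma Qlog_cvgpi : Q x @[x --> (pi : R)^'-] --> Q pi.
Proof. exact: (parameterized_integral_cvg_at_left (pi_gt0 R) integrable_lsin2).
  Qed.

(** Arguments are kept in the shape [c * t + d], hence terms like [2 * t + 0] and [-1 * t + pi / 2]
    below, so that this rule and the affine limits apply literally. *)
Lemma der_comp_affine (F : R -> R) x c d dF : is_derive (c * x + d) 1 F dF ->
  is_derive x 1 (fun t => F (c * t + d)) (c * dF).
Proof.
move=> h; rewrite mulrC; apply: (@derL _ F (fun t => c * t + d) _ _ h).
by der; ring.
Qed.

Section reflection.
Variables (F f : R -> R).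
Hypothesis dF : forall x, 0 < x < pi -> is_derive x 1 F (f x).
Hypothesis f_piB : forall x, f (pi - x) = f x.
Hypothesis F0 : F x @[x --> (0 : R)^'+] --> 0.
Hypothesis Fpi : F x @[x --> (pi : R)^'-] --> F pi.

(** F(pi - t) + F(t) has derivative 0, and its limit at 0 is F(pi). Stated for an abstract [F] to
    serve both S and Q. *)
Lemma primitive_piB x : 0 < x < pi -> F (pi - x) = F pi - F x.
Proof.
move=> xi; have /andP[x0 xpi] := xi.
pose G t := F (-1 * t + pi) + F t.
have dG t : 0 < t < pi -> is_derive t 1 G 0.
  move=> ti; have ti' : 0 < -1 * t + pi < pi by move: ti => /andP[? ?];
    apply/andP; lra.
  have d1 := dF ti; have d2 := der_comp_affine (dF ti').
  have := derD d2 d1.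
  by rewrite (_ : -1 * t + pi = pi - t) ?f_piB ?mulN1r ?addNr// addrC.
have : F pi + 0 = G x.
  apply: (@is_derive0_eq _ G 0 x) => //.
  - by move=> t /andP[? ?]; apply: dG; apply/andP; lra.
  - apply: cvgD => //.
    apply: cvg_comp Fpi; apply: affine_right_left; lra.
  - exact: is_derive_cvg_left (dG _ xi).
by rewrite addr0 /G => ->; rewrite (_ : -1 * x + pi = pi - x); ring.
Qed.

End reflection.

Lemma Slog_piB x : 0 < x < pi -> S (pi - x) = S pi - S x.
Proof.
exact: (primitive_piB (@der_Slog R) (@lsin_piB R) (@Slog_cvg0 R) Slog_cvgpi).
Qed.

Lemma Qlog_piB x : 0 < x < pi -> Q (pi - x) = Q pi - Q x.
Proof.
apply: (primitive_piB (@der_Qlog R)) => //.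
- by move=> y; rewrite lsin_piB.
- exact: Qlog_cvg0.
- exact: Qlog_cvgpi.
Qed.

Lemma pihalf_in : 0 < (pi / 2 : R) < pi.
Proof. by have := pi_gt0 R => p; apply/andP; lra. Qed.

Lemma Qlog_pi : Q pi = 2 * Q (pi / 2).
Proof.
have := Qlog_piB pihalf_in; rewrite (_ : (pi - pi / 2 : R) = pi / 2);
  last by field.
by move=> h; lra.
Qed.

(** The duplication defect of S. It is constant because log(2 sin 2t) = log(2 sin t) + log(2 cos
    t). *)
Let G t := S (2 * t + 0) - 2 * S t + 2 * S (-1 * t + pi / 2).

Let dG t : 0 < t < pi / 2 -> is_derive t 1 G 0.
Proof.
move=> ti; have /andP[t0 t1] := ti.
have d1 : is_derive t 1 (fun t => S (2 * t + 0)) (2 * lsin (2 * t + 0)).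
  by apply: der_comp_affine; apply: der_Slog; apply/andP; lra.
have d2 : is_derive t 1 S (lsin t) by apply: der_Slog; apply/andP; lra.
have d3 : is_derive t 1 (fun t => S (-1 * t + pi / 2)) (-1 * lsin (-1 * t + pi /
  2)).
  by apply: der_comp_affine; apply: der_Slog; apply/andP; lra.
rewrite /G; der.
rewrite (addr0 (2 * t)) lsin_double// (_ : -1 * t + pi / 2 = pi / 2 - t)
  ?lsin_pihalfB; last by ring.
by ring.
Qed.

Let G_0 : G x @[x --> (0 : R)^'+] --> 2 * S (pi / 2).
Proof.
rewrite -[X in _ --> X](_ : 0 - 2 * 0 + 2 * S (pi / 2) = _); last by ring.
apply: cvgD; last first.
  apply: cvgM; first exact: cvg_cst.
  have := is_derive_cvg_left (der_Slog pihalf_in).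
  by apply: cvg_comp; apply: affine_right_left; lra.
apply: cvgB; last by apply: cvgM; [exact: cvg_cst|exact: Slog_cvg0].
apply: cvg_comp (@Slog_cvg0 R); apply: affine_right_right; lra.
Qed.

(** Euler's integral. Equating the limits of [G] at 0 and pi/2 gives 2 S(pi/2) = S(pi) - 2 S(pi/2),
    while reflection gives S(pi) = 2 S(pi/2). *)
Lemma Slog_pihalf : S (pi / 2) = 0.
Proof.
have : 2 * S (pi / 2) = S pi - 2 * S (pi / 2) + 2 * 0.
  apply: (@is_derive0_eq _ G 0 (pi / 2)) => //.
  - exact: pihalf_gt0.
  - apply: cvgD; last first.
      apply: cvgM; first exact: cvg_cst.
      by apply: cvg_comp (@Slog_cvg0 R); apply: affine_left_right; lra.
    apply: cvgB.
      by apply: cvg_comp Slog_cvgpi; apply: affine_left_left; lra.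
    apply: cvgM; first exact: cvg_cst.
    exact: is_derive_cvg_left (der_Slog pihalf_in).
have := Slog_piB pihalf_in; rewrite (_ : (pi - pi / 2 : R) = pi / 2);
  last by field.
by move=> h1 h2; lra.
Qed.

Lemma Slog_double x : 0 < x < pi / 2 -> S (2 * x) = 2 * S x - 2 * S (pi / 2 -
  x).
Proof.
move=> xi; have /andP[x0 x1] := xi.
have : 2 * S (pi / 2) = G x.
  apply: (@is_derive0_eq _ G 0 x) => //.
  - by move=> t /andP[? ?]; apply: dG; apply/andP; lra.
  - exact: is_derive_cvg_left (dG xi).
rewrite Slog_pihalf /G addr0 (_ : -1 * x + pi / 2 = pi / 2 - x); last by ring.
by move=> h; lra.
Qed.

(* By polarization, since lsin (2 t) = lsin t + lcos t, this is the primitive of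
   lsin * lcos vanishing at 0. *)
Definition KSlog b := (Q (2 * b + 0) / 2 - Q b - Q (pi / 2) + Q (-1 * b + pi /
  2)) / 2.

Lemma der_KSlog t : 0 < t < pi / 2 -> is_derive t 1 KSlog (lsin t * lcos t).
Proof.
move=> ti; have /andP[t0 t1] := ti.
have d1 : is_derive t 1 (fun t => Q (2 * t + 0)) (2 * lsin (2 * t + 0) ^+ 2).
  by apply: der_comp_affine; apply: der_Qlog; apply/andP; lra.
have d2 : is_derive t 1 Q (lsin t ^+ 2) by apply: der_Qlog; apply/andP; lra.
have d3 : is_derive t 1 (fun t => Q (-1 * t + pi / 2)) (-1 * lsin (-1 * t + pi /
  2) ^+ 2).
  by apply: (@der_comp_affine Q); apply: der_Qlog; apply/andP; lra.
rewrite /KSlog; der.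
rewrite (addr0 (2 * t)) lsin_double// (_ : -1 * t + pi / 2 = pi / 2 - t)
  ?lsin_pihalfB; last by ring.
by field.
Qed.

Lemma KSlog_cvg0 : KSlog t @[t --> (0 : R)^'+] --> 0.
Proof.
rewrite -[X in _ --> X](_ : (0 / 2 - 0 - Q (pi / 2) + Q (pi / 2)) / 2 = _);
  last by ring.
apply: cvgM; last exact: cvg_cst.
apply: cvgD; last first.
  have := is_derive_cvg_left (der_Qlog pihalf_in).
  by apply: cvg_comp; apply: affine_right_left; lra.
apply: cvgB; last exact: cvg_cst.
apply: cvgB; last exact: Qlog_cvg0.
apply: cvgM; last exact: cvg_cst.
by apply: cvg_comp Qlog_cvg0; apply: affine_right_right; lra.
Qed.

(** The integral of [lsin * lcos] over the full quarter period; Q(pi) = 2 Q(pi/2) cancels one of the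
    two subtracted terms. It is what later determines Q(pi/2). *)
Lemma KSlog_cvg_pihalf : KSlog t @[t --> (pi / 2 : R)^'-] --> - Q (pi / 2) / 2.
Proof.
rewrite -[X in _ --> X](_ : (Q pi / 2 - Q (pi / 2) - Q (pi / 2) + 0) / 2 = _);
  last first.
  by rewrite Qlog_pi; field.
apply: cvgM; last exact: cvg_cst.
apply: cvgD; last by apply: cvg_comp Qlog_cvg0; apply: affine_left_right; lra.
apply: cvgB; last exact: cvg_cst.
apply: cvgB; last exact: is_derive_cvg_left (der_Qlog pihalf_in).
apply: cvgM; last exact: cvg_cst.
by apply: cvg_comp Qlog_cvgpi; apply: affine_left_left; lra.
Qed.

End logsine_values.

(** * Boundary limits and the logarithmic integrals over [0, b] *)

Section logsine_limits.
Context {R : realType}.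
Local Notation mu := (@lebesgue_measure R).
Local Notation S := (@Slog R).
Local Notation Q := (@Qlog R).
Implicit Types x t b : R.

Lemma itv_pihalf_pi x : 0 < x < pi / 2 -> 0 < x < pi.
Proof. by move=> /andP[? ?]; apply/andP; lra. Qed.

(** sin t - t cos t vanishes at 0 and has derivative t sin t >= 0. The inequality compares t with
    sin t wherever the cosine is bounded below. *)
Lemma mul_cos_le_sin x : 0 < x < pi / 2 -> x * cos x <= sin x.
Proof.
move=> xi; have /andP[x0 x1] := xi.
pose F t := sin t - t * cos t.
have dF t : is_derive t 1 F (t * sin t) by rewrite /F; der; ring.
rewrite -subr_ge0 -/(F x) -[X in X <= _](_ : F 0 = 0); last first.
  by rewrite /F sin0 mul0r subrr.
apply: (@ge0_is_derive_le _ (fun t => t * sin t) F 0 x) => //.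
- move=> t _; have : is_derive t 1 (fun t => t * sin t) (sin t + t * cos t) by
    der; ring.
  exact: is_derive_continuous.
- move=> t /andP[t0 tx]; rewrite mulr_ge0 ?(ltW t0)// ltW// sin_gt0_pi// t0.
  by have := pi_gt0 R => p; lra.
- exact: is_derive_cvg_right (dF 0).
- exact: is_derive_cvg_left (dF x).
Qed.

Let id0 : x @[x --> (0 : R)^'+] --> (0 : R).
Proof. by apply: cvg_at_right_filter; exact: cvg_id. Qed.

Lemma mul_lsin2_cvg0 : t * lsin t ^+ 2 @[t --> (0 : R)^'+] --> (0 : R).
Proof.
apply: (@squeeze_cvgr _ _ _ _ (cst 0) (fun t =>
  (2 * sin t) * ln (2 * sin t) ^+ 2)).
- have cosn : \forall t \near (0 : R)^'+, 1 / 2 < cos t.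
    have : cos t @[t --> (0 : R)^'+] --> (1 : R).
      by rewrite -[X in _ --> X]cos0; apply: cvg_at_right_filter;
        exact: continuous_cos.
    by move=> /cvgr_gt; apply; lra.
  near=> t.
  have t0 : 0 < t by near: t; exact: nbhs_right_gt.
  have t1 : t < pi / 2 by near: t; apply: nbhs_right_lt; exact: pihalf_gt0.
  have c : 1 / 2 < cos t by near: t.
  (* This replaces the factor t by 2 sin t, the argument of the logarithm, so that the limit of y
     ln^2 y applies. *)
  have h : t <= 2 * sin t.
    by have := @mul_cos_le_sin t; rewrite t0 t1 => /(_ isT); nra.
  apply/andP; split; first by rewrite mulr_ge0 ?sqr_ge0// ltW.
  by rewrite ler_wpM2r ?sqr_ge0.
- exact: cvg_cst.
- exact: (cvg_comp _ _ sin_cvg_right0 mul_sqr_ln_cvg0).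
Unshelve. all: by end_near. Qed.

Lemma mul_lsin_cvg0 : t * lsin t @[t --> (0 : R)^'+] --> (0 : R).
Proof.
have h : t + t * lsin t ^+ 2 @[t --> (0:R)^'+] --> (0 : R).
  by rewrite -[X in _ --> X]addr0; apply: cvgD => //; exact: mul_lsin2_cvg0.
apply: (@squeeze_cvgr _ _ _ _ (fun t => - (t + t * lsin t ^+ 2)) (fun t =>
  t + t * lsin t ^+ 2)) => //.
- near=> t; have t0 : 0 < t by near: t; exact: nbhs_right_gt.
  by apply/andP; have := sqr_ge0 (lsin t - 1); have := sqr_ge0 (lsin t + 1);
    split; nra.
- by rewrite -[X in _ --> X]oppr0; exact: cvgN.
Unshelve. all: by end_near. Qed.

(** The two gaps vanish at 0 and have derivatives 1 - x cot x and x cot x, both nonnegative. The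
    bounds give the size of S near 0, needed for products of S with the singular [lsin]. *)
Lemma Slog_bounds x : 0 < x < pi / 2 -> x * lsin x - x <= S x <= x * lsin x.
Proof.
move=> xi; have /andP[x0 x1] := xi.
have tin t : 0 < t < x -> 0 < t < pi / 2 by move=> /andP[? ?]; apply/andP; lra.
have dl t : 0 < t < pi / 2 -> is_derive t 1 lsin (cos t / sin t).
  by move=> /itv_pihalf_pi; exact: der_lsin.
have dS t : 0 < t < pi / 2 -> is_derive t 1 S (lsin t).
  by move=> /itv_pihalf_pi; exact: der_Slog.
have ccot t : 0 < t < pi / 2 -> {for t, continuous (fun t =>
  t * (cos t / sin t))}.
  move=> /itv_pihalf_pi/sin_gt0_pi s0.
  have [d hd] : exists d, is_derive t 1 (fun t => t * (cos t / sin t)) d.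
    by eexists; repeat (der_step; cbv beta); rewrite gt_eqF.
  exact: is_derive_continuous hd.
apply/andP; split; rewrite -subr_ge0.
- apply: (@ge0_is_derive_le _ (fun t => 1 - t * (cos t / sin t)) (fun t =>
    S t - (t * lsin t - t)) 0 x) => //.
  + by move=> t /tin ti; have d1 := dl _ ti; have d2 := dS _ ti; der; ring.
  + move=> t /tin/ccot h; apply: cvgB => //; exact: cvg_cst.
  + move=> t /tin ti; have s0 := sin_gt0_pi (itv_pihalf_pi ti).
    by rewrite subr_ge0 mulrA ler_pdivrMr// mul1r mul_cos_le_sin.
  + rewrite -[X in _ --> X](_ : 0 - (0 - 0) = 0); last by rewrite !subr0.
    apply: cvgB; first exact: Slog_cvg0.
    apply: cvgB => //; exact: mul_lsin_cvg0.
  + have d1 := dl _ xi; have d2 := dS _ xi.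
    have : is_derive x 1 (fun t => S t - (t * lsin t - t)) (1 - x * (cos x / sin
      x)) by der; ring.
    exact: is_derive_cvg_left.
- apply: (@ge0_is_derive_le _ (fun t => t * (cos t / sin t)) (fun t =>
    t * lsin t - S t) 0 x) => //.
  + by move=> t /tin ti; have d1 := dl _ ti; have d2 := dS _ ti; der; ring.
  + by move=> t /tin/ccot.
  + move=> t /tin ti; have s0 := sin_gt0_pi (itv_pihalf_pi ti);
    have c0 := cos_gt0_oo ti.
    by rewrite mulr_ge0 ?divr_ge0// ltW//; case/andP: ti.
  + rewrite -[X in _ --> X](_ : 0 - 0 = 0); last by rewrite !subr0.
    apply: cvgB; [exact: mul_lsin_cvg0|exact: Slog_cvg0].
  + have d1 := dl _ xi; have d2 := dS _ xi.
    have : is_derive x 1 (fun t => t * lsin t - S t) (x * (cos x / sin x)) by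
      der; ring.
    exact: is_derive_cvg_left.
Qed.

Lemma Slog_lsin_cvg0 : S t * lsin t @[t --> (0 : R)^'+] --> (0 : R).
Proof.
(* With l = [lsin t], the bounds give |S(t)| <= t |l| + t, hence |S(t) l| <= t l^2 + t |l|, and |l|
   <= 1 + l^2. *)
have h : t * lsin t ^+ 2 + (t + t * lsin t ^+ 2) @[t --> (0:R)^'+] --> (0 : R).
  rewrite -[X in _ --> X]addr0 -[X in _ --> _ + X]addr0.
  by apply: cvgD; [|apply: cvgD => //]; exact: mul_lsin2_cvg0.
apply: (@squeeze_cvgr _ _ _ _ (fun t => - (t * lsin t ^+ 2 + (t + t * lsin t ^+
  2)))
   (fun t => t * lsin t ^+ 2 + (t + t * lsin t ^+ 2))) => //.
- near=> t; have t0 : 0 < t by near: t; exact: nbhs_right_gt.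
  have t1 : t < pi / 2 by near: t; apply: nbhs_right_lt; exact: pihalf_gt0.
  have := @Slog_bounds t; rewrite t0 t1 => /(_ isT)/andP[h1 h2].
  have := sqr_ge0 (lsin t - 1); have := sqr_ge0 (lsin t + 1).
  by have [l0|l0] := leP 0 (lsin t) => h3 h4; apply/andP; split; nra.
- by rewrite -[X in _ --> X]oppr0; exact: cvgN.
Unshelve. all: by end_near. Qed.

(** Writing [lsin t] as [lsin (2 * t) - lcos t] reduces to the preceding limit at 2t and to a
    product in which [lcos] is continuous at 0. *)
Lemma Slog_double_lsin_cvg0 : S (2 * t + 0) * lsin t @[t --> (0 : R)^'+] --> (0
  : R).
Proof.
have c2 : S (2 * t + 0) * lsin (2 * t + 0) @[t --> (0 : R)^'+] --> (0 : R).
  by apply: cvg_comp Slog_lsin_cvg0; apply: affine_right_right; lra.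
have c3 : S (2 * t + 0) * lcos t @[t --> (0 : R)^'+] --> (0 * lcos 0 : R).
  apply: cvgM.
    by apply: cvg_comp (@Slog_cvg0 R); apply: affine_right_right; lra.
  have : is_derive (0 : R) 1 lcos 0.
    rewrite /lcos; der; first by rewrite cos0; lra.
    by rewrite cos0 sin0; ring.
  exact: is_derive_cvg_right.
have : S (2 * t + 0) * lsin (2 * t + 0) - S (2 * t + 0) * lcos t @[t --> (0 :
  R)^'+] --> (0 : R).
  by rewrite -[X in _ --> X](_ : 0 - 0 * lcos 0 = 0);
    [exact: cvgB|rewrite mul0r subr0].
apply: cvg_trans; apply: near_eq_cvg; near=> t.
have t0 : 0 < t by near: t; exact: nbhs_right_gt.
have t1 : t < pi / 2 by near: t; apply: nbhs_right_lt; exact: pihalf_gt0.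
rewrite -mulrBr (addr0 (2 * t)) lsin_double ?t0//; congr (_ * _); ring.
Unshelve. all: by end_near. Qed.

(** Put t = pi/2 - s: then [lcos t] is [lsin s], and duplication gives S(pi/2 - s) = S(s) - S(2s)/2,
    so both preceding limits at 0 apply. *)
Lemma Slog_lcos_cvg_pihalf : S t * lcos t @[t --> (pi / 2 : R)^'-] --> (0 : R).
Proof.
have c : S t * lsin t - 2^-1 * (S (2 * t + 0) * lsin t) @[t --> (0 : R)^'+] -->
  (0 : R).
  rewrite -[X in _ --> X](_ : 0 - 2^-1 * 0 = 0); last by rewrite mulr0 subr0.
  apply: cvgB; first exact: Slog_lsin_cvg0.
  by apply: cvgM; [exact: cvg_cst|exact: Slog_double_lsin_cvg0].
have a : -1 * t + pi / 2 @[t --> (pi / 2 : R)^'-] --> (0 : R)^'+.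
  by apply: affine_left_right; lra.
have := cvg_comp _ _ a c; apply: cvg_trans; apply: near_eq_cvg; near=> t.
have t1 : t < pi / 2 by near: t; exact: nbhs_left_lt.
have t0 : 0 < t by near: t; apply: nbhs_left_gt; exact: pihalf_gt0.
have e : -1 * t + pi / 2 = pi / 2 - t by ring.
rewrite /= e addr0 lsin_pihalfB Slog_double; last by apply/andP; lra.
rewrite (_ : pi / 2 - (pi / 2 - t) = t); last by ring.
by field.
Unshelve. all: by end_near. Qed.

Lemma sin_mul_sinB x b : sin (b - x) * sin (b + x) = sin b ^+ 2 - sin x ^+ 2.
Proof.
rewrite sinB sinD; have := cos2Dsin2 x; have := cos2Dsin2 b => hb hx.
rewrite (_ : _ * _ = sin b ^+ 2 * cos x ^+ 2 - cos b ^+ 2 * sin x ^+ 2);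
  last by ring.
rewrite (_ : cos x ^+ 2 = 1 - sin x ^+ 2); last by lra.
rewrite (_ : cos b ^+ 2 = 1 - sin b ^+ 2); last by lra.
by ring.
Qed.

(** The product formula splits the logarithm into [lsin (b - x) + lsin (b + x) - 2 * lsin b], the
    factors 2 cancelling; each summand has a primitive in terms of S. The integrand is singular at x
    = b, where the primitive still has a limit. *)
Lemma integral_ln_sin b : 0 < b < pi / 2 ->
  (\int[mu]_(x in `[0%R, b]) (- ln (1 - (sin x / sin b) ^+ 2))%:E =
   (2 * b * lsin b - S (2 * b))%:E)%E.
Proof.
move=> bi; have /andP[b0 b1] := bi.
have sb := sin_gt0_pi (itv_pihalf_pi bi).
have fE x : 0 < x < b -> 0 < 1 - (sin x / sin b) ^+ 2 <= 1 /\
    - ln (1 - (sin x / sin b) ^+ 2) = - (lsin (b - x) + lsin (b + x) - 2 * lsin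
        b).
  move=> /andP[x0 xb].
  have s1 : 0 < sin (b - x) by apply: sin_gt0_pi; apply/andP; lra.
  have s2 : 0 < sin (b + x) by apply: sin_gt0_pi; apply/andP; lra.
  have e : 1 - (sin x / sin b) ^+ 2 = sin (b - x) * sin (b + x) / sin b ^+ 2.
    by rewrite sin_mul_sinB; field; rewrite gt_eqF.
  split.
    rewrite {1}e divr_gt0 ?mulr_gt0 ?exprn_gt0//=.
    by rewrite gerBl sqr_ge0.
  rewrite e (_ : _ / _ = (2 * sin (b - x)) * (2 * sin (b + x)) / (2 * sin b) ^+
    2); last first.
    by field; rewrite gt_eqF.
  rewrite ln_div ?posrE ?mulr_gt0 ?exprn_gt0 ?mulr_gt0//.
  by rewrite lnM ?posrE ?mulr_gt0// lnXn ?mulr_gt0// -[ln _ *+ 2]mulr_natl.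
pose F x := S (-1 * x + b) - S (1 * x + b) + 2 * x * lsin b.
have dF x : 0 < x < b -> is_derive x 1 F (- ln (1 - (sin x / sin b) ^+ 2)).
  move=> xi; rewrite (fE _ xi).2; have /andP[x0 xb] := xi.
  have d1 : is_derive x 1 (fun x => S (-1 * x + b)) (-1 * lsin (-1 * x + b)).
    by apply: (@der_comp_affine _ S); apply: der_Slog; apply/andP; lra.
  have d2 : is_derive x 1 (fun x => S (1 * x + b)) (1 * lsin (1 * x + b)).
    by apply: (@der_comp_affine _ S); apply: der_Slog; apply/andP; lra.
  rewrite /F; der.
  rewrite (_ : -1 * x + b = b - x); last by ring.
  rewrite (_ : 1 * x + b = b + x); last by ring.
  by ring.
have Sb := der_Slog (itv_pihalf_pi bi).
have S2b : is_derive (2 * b) 1 S (lsin (2 * b)) by apply: der_Slog; apply/andP;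
  lra.
rewrite -[RHS](_ : (0 - S (2 * b) + 2 * b * lsin b - (S b - S b + 2 * 0 * lsin
  b))%:E = _); last first.
  by congr (_%:E); ring.
apply: (@ge0_FTC2_oo _ _ F) => //.
- move=> x xi; have [/andP[p _] _] := fE _ xi.
  have [d hd] : exists d, is_derive x 1 (fun x =>
    - ln (1 - (sin x / sin b) ^+ 2)) d.
    by eexists; repeat (der_step; cbv beta).
  exact: is_derive_continuous hd.
- by move=> x xi; have [/andP[_ p] _] := fE _ xi; rewrite oppr_ge0 ln_le0.
- apply: cvgD; last by apply: cvgM; [apply: cvgM => //;
    exact: cvg_cst|exact: cvg_cst].
  apply: cvgB.
    by apply: cvg_comp (is_derive_cvg_left Sb); apply: affine_right_left; lra.
  by apply: cvg_comp (is_derive_cvg_right Sb); apply: affine_right_right; lra.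
- apply: cvgD; last first.
    apply: cvgM; [apply: cvgM; first exact: cvg_cst|exact: cvg_cst].
    by apply: cvg_at_left_filter; exact: cvg_id.
  apply: cvgB.
    by apply: cvg_comp (@Slog_cvg0 R); apply: affine_left_right; lra.
  by apply: cvg_comp (is_derive_cvg_left S2b); apply: affine_left_left; lra.
Qed.

(** The same factorization with cos^2 x as denominator, so S(pi/2 - x) enters as primitive of
    [lcos]. The raw value -S(2b) - 2 S(pi/2 - b) + 2 S(pi/2) collapses by duplication and S(pi/2) =
    0. *)
Lemma integral_ln_cos b : 0 < b < pi / 2 ->
  (\int[mu]_(x in `[0%R, b]) (- ln (1 - (cos b / cos x) ^+ 2))%:E =
   (- 2 * S b)%:E)%E.
Proof.
move=> bi; have /andP[b0 b1] := bi.
have cb := cos_gt0_oo bi.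
have fE x : 0 < x < b -> 0 < 1 - (cos b / cos x) ^+ 2 <= 1 /\
    - ln (1 - (cos b / cos x) ^+ 2) = - (lsin (b - x) + lsin (b + x) - 2 * lcos
        x).
  move=> /andP[x0 xb].
  have s1 : 0 < sin (b - x) by apply: sin_gt0_pi; apply/andP; lra.
  have s2 : 0 < sin (b + x) by apply: sin_gt0_pi; apply/andP; lra.
  have cx : 0 < cos x by apply: cos_gt0_oo; apply/andP; lra.
  have e : 1 - (cos b / cos x) ^+ 2 = sin (b - x) * sin (b + x) / cos x ^+ 2.
    rewrite sin_mul_sinB !sin2cos2; field; rewrite gt_eqF//.
  split.
    rewrite {1}e divr_gt0 ?mulr_gt0 ?exprn_gt0//=.
    by rewrite gerBl sqr_ge0.
  rewrite e (_ : _ / _ = (2 * sin (b - x)) * (2 * sin (b + x)) / (2 * cos x) ^+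
    2); last first.
    by field; rewrite gt_eqF.
  rewrite ln_div ?posrE ?mulr_gt0 ?exprn_gt0 ?mulr_gt0//.
  by rewrite lnM ?posrE ?mulr_gt0// lnXn ?mulr_gt0// -[ln _ *+ 2]mulr_natl.
pose F x := S (-1 * x + b) - S (1 * x + b) - 2 * S (-1 * x + pi / 2).
have dF x : 0 < x < b -> is_derive x 1 F (- ln (1 - (cos b / cos x) ^+ 2)).
  move=> xi; rewrite (fE _ xi).2; have /andP[x0 xb] := xi.
  have d1 : is_derive x 1 (fun x => S (-1 * x + b)) (-1 * lsin (-1 * x + b)).
    by apply: (@der_comp_affine _ S); apply: der_Slog; apply/andP; lra.
  have d2 : is_derive x 1 (fun x => S (1 * x + b)) (1 * lsin (1 * x + b)).
    by apply: (@der_comp_affine _ S); apply: der_Slog; apply/andP; lra.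
  have d3 : is_derive x 1 (fun x => S (-1 * x + pi / 2)) (-1 * lsin (-1 * x + pi
    / 2)).
    by apply: (@der_comp_affine _ S); apply: der_Slog; apply/andP; lra.
  rewrite /F; der.
  rewrite (_ : -1 * x + b = b - x); last by ring.
  rewrite (_ : 1 * x + b = b + x); last by ring.
  rewrite (_ : -1 * x + pi / 2 = pi / 2 - x); last by ring.
  by rewrite lsin_pihalfB; ring.
have Sb := der_Slog (itv_pihalf_pi bi).
have S2b : is_derive (2 * b) 1 S (lsin (2 * b)) by apply: der_Slog; apply/andP;
  lra.
have Sp := der_Slog (@pihalf_in R).
have Sbp : is_derive (pi / 2 - b) 1 S (lsin (pi / 2 - b)) by apply: der_Slog;
  apply/andP; lra.
rewrite -[RHS](_ : (0 - S (2 * b) - 2 * S (pi / 2 - b) - (S b - S b - 2 * S (pi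
  / 2)))%:E = _); last first.
  by congr (_%:E); rewrite Slog_pihalf Slog_double//; ring.
apply: (@ge0_FTC2_oo _ _ F) => //.
- move=> x xi; have [/andP[p _] _] := fE _ xi.
  have cx : cos x != 0.
    by rewrite gt_eqF//; apply: cos_gt0_oo; move: xi => /andP[? ?]; apply/andP;
      lra.
  have [d hd] : exists d, is_derive x 1 (fun x =>
    - ln (1 - (cos b / cos x) ^+ 2)) d.
    by eexists; repeat (der_step; cbv beta).
  exact: is_derive_continuous hd.
- by move=> x xi; have [/andP[_ p] _] := fE _ xi; rewrite oppr_ge0 ln_le0.
- apply: cvgB; last first.
    apply: cvgM; first exact: cvg_cst.
    by apply: cvg_comp (is_derive_cvg_left Sp); apply: affine_right_left; lra.
  apply: cvgB.
    by apply: cvg_comp (is_derive_cvg_left Sb); apply: affine_right_left; lra.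
  by apply: cvg_comp (is_derive_cvg_right Sb); apply: affine_right_right; lra.
- apply: cvgB; last first.
    apply: cvgM; first exact: cvg_cst.
    by apply: cvg_comp (is_derive_cvg_right Sbp); apply: affine_left_right; lra.
  apply: cvgB.
    by apply: cvg_comp (@Slog_cvg0 R); apply: affine_left_right; lra.
  by apply: cvg_comp (is_derive_cvg_left S2b); apply: affine_left_left; lra.
Qed.

End logsine_limits.

(** * Fourier expansion of the logarithm *)

Section log_fourier.
Context {R : realType}.
Local Notation mu := (@lebesgue_measure R).
Implicit Types a r s t x y b : R.

Definition logq a x := ln (1 - 2 * a * cos x + a ^+ 2) / 2.

(* Partial sums of the expansion of - log|1 - a e^{ix}| = - logq a x. *)
Definition cospoly (N : nat) a x : R :=
  \sum_(k < N) a ^+ k.+1 / k.+1%:R * cos (k.+1%:R * x).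

Lemma quad_gt0 a x : `|a| < 1 -> 0 < 1 - 2 * a * cos x + a ^+ 2.
Proof.
move=> a1; have := cos2Dsin2 x.
have : 0 < (1 - a * cos x) ^+ 2.
  rewrite exprn_gt0// subr_gt0 (le_lt_trans (ler_norm _))// normrM.
  by rewrite (le_lt_trans _ a1)// ler_piMr// cos_max.
by have := sqr_ge0 (a * sin x); nra.
Qed.

Lemma quad_ge a x : `|a| < 1 -> (1 - `|a|) ^+ 2 <= 1 - 2 * a * cos x + a ^+ 2.
Proof.
move=> a1; have e : `|a| ^+ 2 = a ^+ 2 by rewrite real_normK ?num_real.
have : a * cos x <= `|a|.
  by rewrite (le_trans (ler_norm _))// normrM ler_piMr// cos_max.
by nra.
Qed.

Lemma cos_succ (n : nat) x :
  cos (n.+2%:R * x) = 2 * cos x * cos (n.+1%:R * x) - cos (n%:R * x).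
Proof.
rewrite (_ : n.+2%:R * x = n.+1%:R * x + x); last by rewrite -[in LHS]natr1;
  ring.
rewrite (_ : n%:R * x = n.+1%:R * x - x); last by rewrite -[in RHS]natr1; ring.
by rewrite cosD cosB; ring.
Qed.

(** Real part of the geometric sum of a^k e^{i(k+1)x}, multiplied by |1 - a e^{ix}|^2 to stay free
    of division. *)
Lemma sum_cos a x (N : nat) :
  (1 - 2 * a * cos x + a ^+ 2) * (\sum_(k < N) a ^+ k * cos (k.+1%:R * x)) =
  cos x - a - a ^+ N * (cos (N.+1%:R * x) - a * cos (N%:R * x)).
Proof.
elim: N => [|N IH]; first by rewrite big_ord0 (mul1r x) (mul0r x) cos0 expr0;
  ring.
by rewrite big_ord_recr/= mulrDr IH cos_succ (exprS a N); ring.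
Qed.

(** Differentiating in a scaling parameter s removes the denominators k + 1 and leaves the geometric
    sum. *)
Lemma der_cospoly (N : nat) a x s :
  is_derive s 1 (fun s => cospoly N (s * a) x)
    (a * \sum_(k < N) (s * a) ^+ k * cos (k.+1%:R * x)).
Proof.
elim: N => [|N IH].
  rewrite big_ord0 mulr0 (_ : (fun _ => _) = cst 0); first exact: der_cst.
  by apply/funext => u; rewrite /cospoly big_ord0.
rewrite (_ : (fun _ => _) = (fun s => cospoly N (s * a) x +
    (s * a) ^+ N.+1 / N.+1%:R * cos (N.+1%:R * x))); last first.
  by apply/funext => u; rewrite /cospoly big_ord_recr.
rewrite big_ord_recr/= mulrDr; der.
congr (_ + _); rewrite /=; field.
by rewrite nat1r pnatr_eq0.
Qed.

(** Mean value theorem in s on [0, 1], with a replaced by s a: the sum vanishes at s = 0, and its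
    derivative is the remainder of the geometric sum. The 2 bounds the two cosines, and (1 - |a|)^2
    bounds the denominator from below. *)
Lemma cospoly_logq (N : nat) a x : `|a| < 1 ->
  `|cospoly N a x + logq a x| <= 2 * `|a| ^+ N / (1 - `|a|) ^+ 2.
Proof.
move=> a1; pose D s := cospoly N (s * a) x + logq (s * a) x.
(* The main term cos x - s a of [sum_cos] cancels against the derivative of [logq], leaving only
   this tail. *)
pose E s := a * (- (s * a) ^+ N * (cos (N.+1%:R * x) - (s * a) * cos (N%:R * x))
  /
   (1 - 2 * (s * a) * cos x + (s * a) ^+ 2)).
have sa1 s : 0 <= s <= 1 -> `|s * a| <= `|a|.
  by move=> /andP[s0 s1]; rewrite normrM ger0_norm// ler_piMl.
have dD s : 0 <= s <= 1 -> is_derive s 1 D (E s).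
  move=> si; have q0 := @quad_gt0 (s * a) x (le_lt_trans (sa1 _ si) a1).
  have dc := der_cospoly N a x s.
  have dl : is_derive s 1 (fun s => logq (s * a) x) (a * (s * a - cos x) / (1 -
    2 * (s * a) * cos x + (s * a) ^+ 2)).
    rewrite /logq; der; first by [].
    by rewrite /=; field; rewrite gt_eqF.
  apply: (der_eq (derD dc dl)); rewrite /E.
  have := sum_cos (s * a) x N.
  set T := \sum_(_ < _) _; set q := 1 - _ + _; move=> h.
  have -> : T = (cos x - s * a - (s * a) ^+ N * (cos (N.+1%:R * x) - s * a * cos
    (N%:R * x))) / q.
    by rewrite -h mulrC mulKf// gt_eqF.
  by field; rewrite gt_eqF.
have [|||c ci] := @MVT R D E 0 1.
- by [].
- by move=> s si; apply: dD; rewrite !ltW ?(itvP si).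
- apply: derivable_within_continuous => s si.
  by have [] := dD s (si).
rewrite {1}/D mul1r {1}/D mul0r subr0 mulr1.
have -> : cospoly N 0 x + logq 0 x = 0.
  rewrite /logq mulr0 mul0r subr0 expr0n addr0 ln1 mul0r addr0 /cospoly big1//
    => k _.
  by rewrite exprS !mul0r.
rewrite subr0 => ->.
have ci' : 0 <= c <= 1 by rewrite !ltW ?(itvP ci).
have ca := sa1 _ ci'; have ca1 := le_lt_trans ca a1.
have q0 := @quad_gt0 (c * a) x ca1.
rewrite /E normrM (le_trans (ler_piMl _ (ltW a1)))//.
rewrite normrM normfV (gtr0_norm q0).
have h1 : (1 - `|a|) ^+ 2 <= 1 - 2 * (c * a) * cos x + (c * a) ^+ 2.
  apply: (le_trans _ (quad_ge x ca1)).
  by apply: lerXn2r; rewrite ?nnegrE ?subr_ge0 ?(ltW a1) ?(ltW ca1)// lerD2l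
    lerN2.
have h2 : `|- (c * a) ^+ N * (cos (N.+1%:R * x) - c * a * cos (N%:R * x))| <= 2
  * `|a| ^+ N.
  rewrite normrM normrN normrX mulrC ler_pM//; last first.
    by rewrite lerXn2r ?nnegrE.
  rewrite (le_trans (ler_normB _ _))// -[2]/(1 + 1) lerD ?cos_max//.
  by rewrite normrM mulr_ile1 ?cos_max// ltW.
apply: ler_pM => //; first by rewrite invr_ge0 ltW.
by rewrite lef_pV2// posrE ?exprn_gt0 ?subr_gt0.
Qed.

Lemma cospoly_cvg a x : `|a| < 1 -> cospoly N a x @[N --> \oo] --> - logq a x.
Proof.
move=> a1.
have h : 2 * `|a| ^+ N / (1 - `|a|) ^+ 2 @[N --> \oo] --> (0 : R).
  rewrite -[X in _ --> X](mul0r ((1 - `|a|) ^- 2)); apply: cvgM;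
    last exact: cvg_cst.
  rewrite -[X in _ --> X](mulr0 2); apply: cvgM; first exact: cvg_cst.
  by apply: cvg_expr; rewrite normr_id.
apply/cvgrPdist_le => e e0; have /cvgrPdist_le/(_ _ e0) := h.
apply: filterS => N; rewrite sub0r normrN => hN.
rewrite -opprD normrN addrC; apply: (le_trans (cospoly_logq N x a1)).
exact: le_trans (ler_norm _) hN.
Qed.

(** A geometric bound independent of N and x: the dominating constant for the passage to the limit
    under the integral. *)
Lemma cospoly_le (N : nat) a x : `|a| < 1 -> `|cospoly N a x| <= (1 - `|a|)^-1.
Proof.
move=> a1; have p : 0 < 1 - `|a| by rewrite subr_gt0.
apply: (@le_trans _ _ (\sum_(k < N) `|a| ^+ k)).
  rewrite (le_trans (ler_norm_sum _ _ _))//; apply: ler_sum => k _.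
  rewrite !normrM normrX exprSr -!mulrA ler_piMr ?exprn_ge0//.
  rewrite !mulr_ile1 ?mulr_ge0 ?cos_max ?(ltW a1)// ger0_norm// invf_le1//
    ler1n//.
rewrite -[leRHS]mul1r ler_pdivlMr//.
suff -> : (\sum_(k < N) `|a| ^+ k) * (1 - `|a|) = 1 - `|a| ^+ N by rewrite gerBl
  exprn_ge0.
elim: N => [|N IH]; first by rewrite big_ord0 expr0 mul0r subrr.
by rewrite big_ord_recr/= mulrDl IH exprS; ring.
Qed.

End log_fourier.

(** * The Basel sum *)

Section basel.
Context {R : realType}.
Local Notation mu := (@lebesgue_measure R).
Implicit Types t x : R.

(** Matsuoka's telescoping proof, with J the same integral weighted by t^2: J_n/I_n -
    J_{n+1}/I_{n+1} = 1/(2(n+1)^2), J_0/I_0 = pi^2/12, and J_n/I_n tends to 0. *)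
Let I (n : nat) : R := \int[mu]_(t in `[0, (pi / 2 : R)]) (cos t ^+ n.*2).
Let J (n : nat) : R := \int[mu]_(t in `[0, (pi / 2 : R)]) (t ^+ 2 * cos t ^+
  n.*2).

Lemma continuous_integrable (f : R -> R) (a b : R) : continuous f ->
  mu.-integrable `[a, b] (EFin \o f).
Proof.
move=> cf; apply: continuous_compact_integrable; first exact: segment_compact.
exact: continuous_subspaceT.
Qed.

Lemma FTC2_continuous (f F : R -> R) (a b : R) : a < b -> continuous f ->
  (forall x, is_derive x 1 F (f x)) ->
  (\int[mu]_(x in `[a, b]) (f x)%:E = (F b - F a)%:E)%E.
Proof.
move=> ab cf dF; rewrite EFinB; apply: continuous_FTC2 => //.
- exact: continuous_subspaceT.
- split.
  + by move=> x _; have [] := dF x.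
  + exact: is_derive_cvg_right (dF _).
  + exact: is_derive_cvg_left (dF _).
- by move=> x _; rewrite derive1E; apply: derive_val; exact: dF.
Qed.

Lemma RFTC2_continuous (f F : R -> R) (a b : R) : a < b -> continuous f ->
  (forall x, is_derive x 1 F (f x)) ->
  \int[mu]_(x in `[a, b]) (f x) = F b - F a.
Proof. by move=> ab cf dF; rewrite /Rintegral (FTC2_continuous ab cf dF). Qed.

Let cosX_continuous (n : nat) : continuous (fun t : R => cos t ^+ n).
Proof.
move=> t; have : is_derive t 1 (fun t => cos t ^+ n) (n%:R * cos t ^+ n.-1 * (-
  sin t * 1)) by der.
exact: is_derive_continuous.
Qed.

Let sqr_cosX_continuous (n : nat) : continuous (fun t : R =>
  t ^+ 2 * cos t ^+ n).
Proof.
move=> t; have [d hd] : exists d, is_derive t 1 (fun t =>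
  t ^+ 2 * cos t ^+ n) d.
  by eexists; repeat (der_step; cbv beta).
exact: is_derive_continuous hd.
Qed.

Let scale_continuous (k : R) (f : R -> R) : continuous f ->
  continuous (fun t => k * f t).
Proof. by move=> cf t; apply: cvgM; [exact: cvg_cst|exact: cf]. Qed.

Let I0 : I 0 = pi / 2.
Proof.
rewrite /I (@RFTC2_continuous _ (fun t => t)) ?subr0//; first exact: pihalf_gt0.
Qed.

Let J0 : J 0 = pi ^+ 3 / 24.
Proof.
have dF t : is_derive t 1 (fun t => t ^+ 3 / 3) (t ^+ 2 * cos t ^+ 0).
  by der; rewrite /= expr0; field.
rewrite /J (RFTC2_continuous (@pihalf_gt0 R) (@sqr_cosX_continuous 0) dF).
by field.
Qed.

Let I_rec (n : nat) : (2 * n.+1%:R) * I n.+1 = (2 * n.+1%:R - 1) * I n.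
Proof.
apply/eqP; rewrite -subr_eq0 /I; apply/eqP.
rewrite -!RintegralZl//; try exact: continuous_integrable.
rewrite -RintegralB//; try by apply: continuous_integrable;
  exact: scale_continuous.
(* This primitive vanishes at both 0 and pi/2, which makes the combination of integrals zero. *)
have dF t : is_derive t 1 (fun t => cos t ^+ n.*2.+1 * sin t)
    (2 * n.+1%:R * cos t ^+ n.+1.*2 - (2 * n.+1%:R - 1) * cos t ^+ n.*2).
  der => /=; rewrite doubleS !exprS -muln2 -!natr1 natrM.
  have := sin2cos2 t; rewrite expr2 => e.
  transitivity (cos t ^+ (n * 2) * (cos t ^+ 2 - (n%:R * 2 + 1) * (sin t * sin
    t))); first ring.
  by rewrite e; ring.
rewrite (RFTC2_continuous (@pihalf_gt0 R) _ dF).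
  by rewrite cos_pihalf sin0 exprS; ring.
move=> t; have [d hd] : exists d, is_derive t 1 (fun t =>
    2 * n.+1%:R * cos t ^+ n.+1.*2 - (2 * n.+1%:R - 1) * cos t ^+ n.*2) d.
  by eexists; repeat (der_step; cbv beta).
exact: is_derive_continuous hd.
Qed.

Let J_rec (n : nat) : I n.+1 = n.+1%:R * (2 * n.+1%:R - 1) * J n - 2 * n.+1%:R
  ^+ 2 * J n.+1.
Proof.
apply/eqP; rewrite -subr_eq0 /I /J; apply/eqP.
rewrite -!RintegralZl//; try exact: continuous_integrable.
rewrite -RintegralB//; try by apply: continuous_integrable;
  exact: scale_continuous.
rewrite -RintegralB//; last 2 first.
- exact: continuous_integrable.
- apply: continuous_integrable => t; have [d hd] : exists d,
    is_derive t 1 (fun t =>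
    n.+1%:R * (2 * n.+1%:R - 1) * (t ^+ 2 * cos t ^+ n.*2) -
      2 * n.+1%:R ^+ 2 * (t ^+ 2 * cos t ^+ n.+1.*2)) d.
    by eexists; repeat (der_step; cbv beta).
  exact: is_derive_continuous hd.
(* Two integrations by parts of cos^{2n+2} gathered into one primitive, again zero at both ends. *)
have dF t : is_derive t 1 (fun t => t * cos t ^+ n.+1.*2 + n.+1%:R * (t ^+ 2 *
  cos t ^+ n.*2.+1 * sin t))
    (cos t ^+ n.+1.*2 - (n.+1%:R * (2 * n.+1%:R - 1) * (t ^+ 2 * cos t ^+ n.*2)
      -
      2 * n.+1%:R ^+ 2 * (t ^+ 2 * cos t ^+ n.+1.*2))).
  der => /=; rewrite doubleS !exprS -muln2 -!natr1 natrM.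
  have := sin2cos2 t; rewrite expr2 => e.
  transitivity (cos t ^+ (n * 2) * (cos t ^+ 2 + (n%:R + 1) * t ^+ 2 * (cos t ^+
    2 - (n%:R * 2 + 1) * (sin t * sin t)))); first ring.
  by rewrite e; ring.
rewrite (RFTC2_continuous (@pihalf_gt0 R) _ dF).
  by rewrite cos_pihalf sin0 !exprS; ring.
move=> t; have [d hd] : exists d, is_derive t 1 (fun t =>
    cos t ^+ n.+1.*2 - (n.+1%:R * (2 * n.+1%:R - 1) * (t ^+ 2 * cos t ^+ n.*2) -
      2 * n.+1%:R ^+ 2 * (t ^+ 2 * cos t ^+ n.+1.*2))) d.
  by eexists; repeat (der_step; cbv beta).
exact: is_derive_continuous hd.
Qed.

Let I_gt0 (n : nat) : 0 < I n.
Proof.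
elim: n => [|n IH]; first by rewrite I0 pihalf_gt0.
have h : 0 < n.+1%:R :> R by rewrite ltr0n.
have h1 : 1 <= n.+1%:R :> R by rewrite ler1n.
have h2 : 0 < 2 * n.+1%:R :> R by rewrite mulr_gt0.
by rewrite -(pmulr_rgt0 _ h2) I_rec mulr_gt0//; lra.
Qed.

(** Divide [J_rec] by 2(n+1)^2 I_{n+1}; [I_rec] turns the coefficient of J_n into 1/I_n. *)
Let JI_step (n : nat) : J n / I n - J n.+1 / I n.+1 = 1 / (2 * n.+1%:R ^+ 2).
Proof.
have h : 0 < n.+1%:R :> R by rewrite ltr0n.
have i0 := I_gt0 n; have i1 := I_gt0 n.+1.
have e1 := I_rec n; have e2 := J_rec n.
have e3 : J n.+1 = (n.+1%:R * (2 * n.+1%:R - 1) * J n - I n.+1) / (2 * n.+1%:R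
  ^+ 2).
  by rewrite e2; field; rewrite gt_eqF.
rewrite e3 (_ : (2 * n.+1%:R - 1) = 2 * n.+1%:R * I n.+1 / I n);
  last by rewrite e1; field; rewrite gt_eqF.
by field; rewrite !gt_eqF.
Qed.

(** A crude form of Jordan's inequality. If cos t >= 1/4, use t cos t <= sin t; otherwise sin t >
    1/2 and t <= pi/2 < 2. *)
Let le_4sin t : 0 <= t <= pi / 2 -> 0 <= t <= 4 * sin t.
Proof.
have p2 : (pi / 2 : R) < 2 by exact: pihalf_lt2.
move=> /andP[t0 t1]; rewrite t0/=; move: t0 t1;
  rewrite le_eqVlt => /predU1P[<-|t0].
  by rewrite sin0 mulr0.
rewrite le_eqVlt => /predU1P[->|t1]; first by rewrite sin_pihalf; lra.
have ti : 0 < t < pi / 2 by rewrite t0.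
have := mul_cos_le_sin ti; have s0 := sin_gt0_pi (itv_pihalf_pi ti);
  have := cos2Dsin2 t.
by have [c|c] := leP (1 / 4) (cos t); have := cos_gt0_oo ti => h1 h2 h3; nra.
Qed.

(** From t <= 4 sin t, the integrand of J_n is at most 16 sin^2 t cos^{2n} t = 16 (cos^{2n} t -
    cos^{2n+2} t), and I_n - I_{n+1} = I_n/(2(n+1)) by [I_rec]. *)
Let JI_le (n : nat) : 0 <= J n / I n <= 16 / n.+1%:R.
Proof.
have h : 0 < n.+1%:R :> R by rewrite ltr0n.
have i0 := I_gt0 n.
have J0le : 0 <= J n.
  apply: Rintegral_ge0 => t _.
  by rewrite mulr_ge0 ?sqr_ge0// -muln2 exprM sqr_ge0.
rewrite divr_ge0 ?(ltW i0)//= ler_pdivrMr//.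
have : J n <= 16 * (I n - I n.+1).
  rewrite /I -RintegralB//; try exact: continuous_integrable.
  have cd : continuous (fun t : R => cos t ^+ n.*2 - cos t ^+ n.+1.*2).
    move=> t; have [d hd] : exists d, is_derive t 1 (fun t =>
      cos t ^+ n.*2 - cos t ^+ n.+1.*2) d.
      by eexists; repeat (der_step; cbv beta).
    exact: is_derive_continuous hd.
  rewrite -RintegralZl//; last exact: continuous_integrable.
  apply: le_Rintegral => //; try exact: continuous_integrable.
    by apply: continuous_integrable; exact: scale_continuous.
  move=> t /=; rewrite in_itv/= => /le_4sin/andP[t0 t1].
  have -> : cos t ^+ n.*2 - cos t ^+ n.+1.*2 = sin t ^+ 2 * cos t ^+ n.*2.
    by rewrite doubleS (exprS _ n.*2.+1) (exprS _ n.*2) sin2cos2; ring.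
  rewrite mulrA ler_wpM2r//; first by rewrite -muln2 exprM sqr_ge0.
  by nra.
have := I_rec n => e h1.
have : I n.+1 = I n - I n / (2 * n.+1%:R).
  by apply: (@mulfI _ (2 * n.+1%:R)); [rewrite gt_eqF ?mulr_gt0|rewrite e;
    field; rewrite gt_eqF].
move=> e1; apply: (le_trans h1); rewrite e1.
rewrite (_ : 16 * _ = 8 / n.+1%:R * I n); last by field; rewrite gt_eqF.
by rewrite ler_wpM2r ?(ltW i0)// ler_wpM2r ?invr_ge0 ?(ltW h)//; lra.
Qed.

Lemma basel : (\sum_(k <oo) (1 / k.+1%:R ^+ 2)%:E = (pi ^+ 2 / 6 : R)%:E)%E.
Proof.
have sumE N : \sum_(k < N) (1 / k.+1%:R ^+ 2) = 2 * (pi ^+ 2 / 12 - J N / I N)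
  :> R.
  elim: N => [|N IH].
    rewrite big_ord0 I0 J0; move: (pi_gt0 R); generalize (pi : R) => p p0.
    by field; rewrite gt_eqF.
  rewrite big_ord_recr/= IH -(_ : 2 * (J N / I N - J N.+1 / I N.+1) = 1 /
    N.+1%:R ^+ 2).
    by ring.
  rewrite JI_step; field.
  by rewrite nat1r pnatr_eq0.
have c0 : J n / I n @[n --> \oo] --> (0 : R).
  apply: (@squeeze_cvgr _ _ _ _ (cst 0) (fun n => 16 / n.+1%:R)).
  - by apply: nearW => n; exact: JI_le.
  - exact: cvg_cst.
  - rewrite -[X in _ --> X](mulr0 16); apply: cvgM; first exact: cvg_cst.
    exact: cvg_harmonic.
apply/cvg_lim => //.
rewrite (_ : (fun n => _) = (fun n => (2 * (pi ^+ 2 / 12 - J n / I n))%:E));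
  last first.
  by apply/funext => n; rewrite -sumE -sumEFin big_mkord.
apply: cvg_EFin; first exact: nearW.
rewrite -[X in _ --> X](_ : 2 * (pi ^+ 2 / 12 - 0) = _); last by field.
by apply: cvgM; [exact: cvg_cst|apply: cvgB => //; exact: cvg_cst].
Qed.

End basel.

(** * Circle means *)

Section circle_mean.
Context {R : realType}.
Local Notation mu := (@lebesgue_measure R).
Implicit Types (a b c v w t x : R) (f g : R -> R).

(** Integration over [0, 1] by explicit primitives. It is linear without integrability side
    conditions, so orthogonality is settled algebraically and converted to Lebesgue integrals once,
    in [integral_has_prim01]. *)
Definition has_prim01 f v :=
  exists2 F : R -> R, forall x, is_derive x 1 F (f x) & F 1 - F 0 = v.

Lemma has_prim01D f g v w : has_prim01 f v -> has_prim01 g w ->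
  has_prim01 (fun t => f t + g t) (v + w).
Proof.
move=> [F dF <-] [G dG <-]; exists (fun t => F t + G t); last by ring.
by move=> x; exact: derD.
Qed.

Lemma has_prim01Z c f v : has_prim01 f v -> has_prim01 (fun t =>
  c * f t) (c * v).
Proof.
move=> [F dF <-]; exists (fun t => c * F t); last by ring.
by move=> x; have d := dF x; der; ring.
Qed.

Lemma has_prim01_cst c : has_prim01 (fun=> c) c.
Proof. by exists (fun t => c * t) => [x|]; [der; ring|ring]. Qed.

Lemma has_prim01_eq f g v w : f =1 g -> v = w -> has_prim01 f v ->
  has_prim01 g w.
Proof. by move=> /funext -> ->. Qed.

(** As t runs over [0, 1] the sine primitive goes through m + 1 full periods, so the phase [b],
    later [pi * u], has no influence. The frequency is a successor to exclude the constant mode. *)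
Lemma has_prim01_cos (m : nat) b :
  has_prim01 (fun t => cos (m.+1%:R * (2 * pi * t - b))) 0.
Proof.
have p0 := pi_gt0 R; have m0 : 0 < m.+1%:R :> R by rewrite ltr0n.
exists (fun t => sin (m.+1%:R * (2 * pi * t - b)) / (m.+1%:R * (2 * pi))).
  move=> x; der; rewrite /=; move: p0 m0; generalize (pi : R) (m.+1%:R : R) =>
    p M p0 m0.
  by field; rewrite !gt_eqF.
rewrite -mulrBl (_ : m.+1%:R * (2 * pi * 1 - b) = m.+1%:R * (2 * pi * 0 - b) +
  pi *+ 2 *+ m.+1).
  by rewrite (periodicn (@sinD2pi R)) subrr mul0r.
by rewrite -[pi *+ 2 *+ _]mulr_natl -[pi *+ 2]mulr_natl; ring.
Qed.

Lemma has_prim01_coscos (k N : nat) b : (k < N)%N ->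
  has_prim01 (fun t => cos (k.+1%:R * (2 * pi * t - b)) * cos (N.+1%:R * (2 * pi
    * t - b))) 0.
Proof.
(* Product to sum, with frequencies (N + 1) + (k + 1) and N - k; both are positive, and each index
   is one below its frequency. *)
move=> kN; have h1 := has_prim01_cos (N + k).+1 b;
  have h2 := has_prim01_cos (N - k).-1 b.
apply: has_prim01_eq (has_prim01Z (1 / 2) (has_prim01D h1 h2)); last by ring.
move=> t; set x := 2 * pi * t - b.
rewrite prednK ?subn_gt0// natrB ?(ltnW kN)//.
rewrite (_ : (N + k).+2%:R * x = N.+1%:R * x + k.+1%:R * x); last first.
  by rewrite -mulrDl -natrD addSn addnS.
rewrite (_ : (N%:R - k%:R) * x = N.+1%:R * x - k.+1%:R * x); last first.
  by rewrite -mulrBl -!natr1; ring.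
by rewrite cosD cosB; field.
Qed.

Lemma has_prim01_cos2 (N : nat) b :
  has_prim01 (fun t => cos (N.+1%:R * (2 * pi * t - b)) ^+ 2) (1 / 2).
Proof.
have h := has_prim01_cos (N + N).+1 b.
apply: has_prim01_eq (has_prim01Z (1 / 2) (has_prim01D h (has_prim01_cst 1)));
  last by ring.
move=> t; set x := 2 * pi * t - b.
rewrite (_ : (N + N).+2%:R * x = N.+1%:R * x + N.+1%:R * x); last first.
  by rewrite -mulrDl -natrD addSn addnS.
by rewrite cosD -!expr2 sin2cos2; field.
Qed.

Lemma has_prim01_cospoly (N : nat) a b :
  has_prim01 (fun t => cospoly N a (2 * pi * t - b)) 0.
Proof.
elim: N => [|N IH].
  by apply: has_prim01_eq (has_prim01_cst 0) => // t; rewrite /cospoly big_ord0.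
apply: has_prim01_eq (has_prim01D IH (has_prim01Z (a ^+ N.+1 / N.+1%:R)
  (has_prim01_cos N b))).
  by move=> t; rewrite /cospoly big_ord_recr.
by rewrite mulr0 addr0.
Qed.

Lemma has_prim01_cospoly_cos (N M : nat) a b : (N <= M)%N ->
  has_prim01 (fun t => cospoly N a (2 * pi * t - b) * cos (M.+1%:R * (2 * pi * t
    - b))) 0.
Proof.
elim: N => [|N IH] NM.
  by apply: has_prim01_eq (has_prim01_cst 0) => // t;
    rewrite /cospoly big_ord0 mul0r.
apply: has_prim01_eq (has_prim01D (IH (ltnW NM))
  (has_prim01Z (a ^+ N.+1 / N.+1%:R) (has_prim01_coscos b NM))).
  by move=> t; rewrite /cospoly big_ord_recr/=; ring.
by rewrite mulr0 addr0.
Qed.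

(** Parseval for the partial sums: the new term has a higher frequency than all earlier ones, so the
    cross term vanishes and half the squared coefficient is added. *)
Lemma has_prim01_cospoly2 (N : nat) a b :
  has_prim01 (fun t => cospoly N a (2 * pi * t - b) ^+ 2)
    (\sum_(k < N) (a ^+ 2) ^+ k.+1 / (2 * k.+1%:R ^+ 2)).
Proof.
elim: N => [|N IH].
  by apply: has_prim01_eq (has_prim01_cst 0); [move=> t;
    rewrite /cospoly big_ord0 expr0n|rewrite big_ord0].
pose A := a ^+ N.+1 / N.+1%:R.
have h1 := has_prim01_cospoly_cos a b (leqnn N).
have h2 := has_prim01_cos2 N b.
apply: has_prim01_eq (has_prim01D IH (has_prim01D (has_prim01Z (2 * A) h1)
  (has_prim01Z (A ^+ 2) h2))).
  by move=> t; rewrite /cospoly !big_ord_recr/= -/A; ring.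
rewrite big_ord_recr/=; congr (_ + _); rewrite mulr0 add0r /A -exprM mulnC
  exprM.
by field; rewrite nat1r pnatr_eq0.
Qed.

Lemma cospoly_der (N : nat) a x : exists d, is_derive x 1 (cospoly N a) d.
Proof.
elim: N => [|N [d hd]].
  exists 0; rewrite (_ : cospoly 0 a = cst 0); first exact: der_cst.
  by apply/funext => y; rewrite /cospoly big_ord0.
rewrite (_ : cospoly N.+1 a = fun y => cospoly N a y + a ^+ N.+1 / N.+1%:R * cos
  (N.+1%:R * y)).
  have [e he] : exists e, is_derive x 1 (fun y =>
    a ^+ N.+1 / N.+1%:R * cos (N.+1%:R * y)) e.
    by eexists; repeat (der_step; cbv beta).
  by exists (d + e); exact: derD.
by apply/funext => y; rewrite /cospoly big_ord_recr.
Qed.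

Lemma cospoly_continuous (N : nat) a b : continuous (fun t =>
  cospoly N a (2 * pi * t - b)).
Proof.
move=> t; have [d hd] := cospoly_der N a (2 * pi * t - b).
apply: (@is_derive_continuous _ _ _ (d * (2 * pi)));
  apply: (@derL _ (cospoly N a) (fun t => 2 * pi * t - b) _ _ hd).
by der; ring.
Qed.

Lemma integral_has_prim01 f v : continuous f -> has_prim01 f v ->
  (\int[mu]_(t in `[0%R, 1%R]) (f t)%:E = v%:E)%E.
Proof. by move=> cf [F dF <-]; exact: FTC2_continuous. Qed.

Lemma measurable_logq a b :
  measurable_fun setT (fun t => logq a (2 * pi * t - b)).
Proof.
apply: measurable_funM => //; apply: measurableT_comp;
  first exact: measurable_ln.
apply: continuous_measurable_fun => t.
have [d hd] : exists d, is_derive t 1 (fun t =>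
  1 - 2 * a * cos (2 * pi * t - b) + a ^+ 2) d.
  by eexists; repeat (der_step; cbv beta).
exact: is_derive_continuous hd.
Qed.

(** The partial sums have mean 0, and domination carries this to the limit. The constant [c] is
    there for the case |a| > 1, where it becomes log|a|. *)
Lemma mean_logq a b c : `|a| < 1 ->
  (\int[mu]_(t in `[0%R, 1%R]) (c + logq a (2 * pi * t - b))%:E = c%:E)%E.
Proof.
move=> a1; pose f N t := (c - cospoly N a (2 * pi * t - b))%:E.
have fE N : (\int[mu]_(t in `[0%R, 1%R]) f N t = c%:E)%E.
  apply: integral_has_prim01.
    by move=> t; apply: cvgB; [exact: cvg_cst|exact: cospoly_continuous].
  apply: has_prim01_eq (has_prim01D (has_prim01_cst c) (has_prim01Z (-1)
    (has_prim01_cospoly N a b))).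
    by move=> t; rewrite mulN1r.
  by rewrite mulr0 addr0.
have [| | | | | |_ _] := @dominated_convergence _ _ R mu `[0%R, 1%R]%classic _ f
  (fun t => (c + logq a (2 * pi * t - b))%:E) (cst (`|c| + (1 - `|a|)^-1)%:E).
- by [].
- move=> N; apply/measurable_EFinP; apply: measurable_funS
    (continuous_measurable_fun _) => //.
  by move=> t; apply: cvgB; [exact: cvg_cst|exact: cospoly_continuous].
- apply/measurable_EFinP; apply: measurable_funS (measurable_funD _
    (measurable_logq a b)) => //.
- apply: aeW => t _; apply: cvg_EFin; first exact: nearW.
  rewrite -[logq _ _]opprK; apply: cvgB; [exact: cvg_cst|exact: cospoly_cvg].
- exact: (@continuous_integrable _ (cst _) 0 1 (fun x => cvg_cst _)).
- apply: aeW => t N _; rewrite /f /= lee_fin (le_trans (ler_normB _ _))//.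
  by rewrite lerD2l cospoly_le.
move=> h; apply: (cvg_unique _ h) => //=.
by rewrite (_ : (fun n => _) = cst c%:E); [exact: cvg_cst|apply/funext => n;
  exact: fE].
Qed.

(** Expanding the square, the cross term with [c] has mean 0, and the partial Parseval sums increase
    to the series. *)
Lemma mean_logq2 a b c : `|a| < 1 ->
  (\int[mu]_(t in `[0%R, 1%R]) ((c + logq a (2 * pi * t - b)) ^+ 2)%:E =
   (c ^+ 2)%:E + \sum_(k <oo) ((a ^+ 2) ^+ k.+1 / (2 * k.+1%:R ^+ 2))%:E)%E.
Proof.
move=> a1; pose f N t := ((c - cospoly N a (2 * pi * t - b)) ^+ 2)%:E.
have cf N : continuous (fun t => (c - cospoly N a (2 * pi * t - b)) ^+ 2).
  by move=> t; apply: (@cvgM R); apply: cvgB; (try exact: cvg_cst);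
    exact: cospoly_continuous.
have fE N : (\int[mu]_(t in `[0%R, 1%R]) f N t =
    (c ^+ 2 + \sum_(k < N) (a ^+ 2) ^+ k.+1 / (2 * k.+1%:R ^+ 2))%:E)%E.
  apply: integral_has_prim01 => //.
  apply: has_prim01_eq (has_prim01D (has_prim01_cst (c ^+ 2)) (has_prim01D
    (has_prim01Z (- (2 * c)) (has_prim01_cospoly N a b)) (has_prim01_cospoly2 N
      a b))).
    by move=> t; ring.
  by rewrite mulr0 add0r.
have [| | | | | |_ _] := @dominated_convergence _ _ R mu `[0%R, 1%R]%classic _ f
  (fun t => ((c + logq a (2 * pi * t - b)) ^+ 2)%:E) (cst ((`|c| + (1 -
    `|a|)^-1) ^+ 2)%:E).
- by [].
- by move=> N; apply/measurable_EFinP; apply: measurable_funS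
    (continuous_measurable_fun _).
- apply/measurable_EFinP; apply: measurable_funX;
    apply: measurable_funS (measurable_funD _ (measurable_logq a b)) => //.
- apply: aeW => t _; apply: cvg_EFin; first exact: nearW.
  rewrite !expr2; apply: cvgM; rewrite -[logq _ _]opprK; apply: cvgB;
    (try exact: cvg_cst); exact: cospoly_cvg.
- exact: (@continuous_integrable _ (cst _) 0 1 (fun x => cvg_cst _)).
- apply: aeW => t N _; rewrite /f /= lee_fin normrX lerXn2r ?nnegrE ?addr_ge0
    ?invr_ge0 ?subr_ge0 ?(ltW a1)//.
  by rewrite (le_trans (ler_normB _ _))// lerD2l cospoly_le.
move=> h; apply: (cvg_unique _ h) => //=.
rewrite (_ : (fun n => _) = (fun N => (c ^+ 2)%:E + \sum_(0 <= k < N) ((a ^+ 2)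
  ^+ k.+1 / (2 * k.+1%:R ^+ 2))%:E)%E).
  apply: cvgeD; [exact: fin_num_adde_defr|exact: cvg_cst|].
  apply: is_cvg_nneseries => k _ _.
  rewrite lee_fin; apply: divr_ge0; first by apply: exprn_ge0; exact: sqr_ge0.
  by apply: mulr_ge0 => //; exact: sqr_ge0.
by apply/funext => N; rewrite fE EFinD sumEFin big_mkord.
Qed.

(** The Fourier expansion at angle 0, where |1 - z e^{ix}| = 1 - z. *)
Lemma ln_series (z : R) : 0 <= z < 1 ->
  (\sum_(k <oo) (z ^+ k.+1 / k.+1%:R)%:E = (- ln (1 - z))%:E)%E.
Proof.
move=> /andP[z0 z1]; apply/cvg_lim => //.
rewrite (_ : (fun n => _) = (fun N => (cospoly N z 0)%:E)); last first.
  apply/funext => N; rewrite big_mkord sumEFin; congr (_%:E).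
  by apply: eq_bigr => k _; rewrite mulr0 cos0 mulr1.
apply: cvg_EFin; first exact: nearW.
rewrite -[ln _](_ : logq z 0 = _).
  by apply: cospoly_cvg; rewrite ger0_norm.
rewrite /logq cos0 (_ : 1 - 2 * z * 1 + z ^+ 2 = (1 - z) ^+ 2); last by ring.
by rewrite lnXn ?subr_gt0// -[ln _ *+ 2]mulr_natl; field.
Qed.

End circle_mean.

(** * Averaging the dilogarithm *)

Section dilog_by_parts.
Context {R : realType}.
Local Notation mu := (@lebesgue_measure R).
Implicit Types x y s : R.
(** [ld] is the logarithmic derivative of [w], and [Lam s] is the integral left after
    differentiating the dilogarithm average in s. The value [w 0 = 0] is allowed, to include the
    sine. *)
Variables (w ld Lam : R -> R) (b : R).
Hypothesis b0 : 0 < b.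
Hypothesis mw : measurable_fun setT w.
Hypothesis cw : forall x, 0 <= x <= b -> {for x, continuous w}.
Hypothesis dw : forall x, 0 < x < b -> is_derive x 1 w (w x * ld x).
Hypothesis w0 : 0 <= w 0.
Hypothesis w_incr : forall x y, 0 <= x -> x < y -> y <= b -> w x < w y.
Hypothesis ld0 : forall x, 0 < x < b -> 0 <= ld x.
Hypothesis cld : forall x, 0 < x < b -> {for x, continuous ld}.
Hypothesis cLam : forall x, 0 < x < b -> {for x, continuous Lam}.
Hypothesis LamE : forall s, 0 < s < b ->
  (\int[mu]_(x in `[0%R, s]) (- ln (1 - (w x / w s) ^+ 2))%:E = (Lam s)%:E)%E.

Let w_ge0 x : 0 <= x <= b -> 0 <= w x.
Proof.
move=> /andP[]; rewrite le_eqVlt => /predU1P[<-//|x0 xb].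
by rewrite ltW// (le_lt_trans w0)// w_incr.
Qed.

Let w_gt0 x : 0 < x <= b -> 0 < w x.
Proof. by move=> /andP[x0 xb]; rewrite (le_lt_trans w0)// w_incr. Qed.

Let W (k : nat) s : R := (\int[mu]_(x in `[0%R, s]) (w x ^+ 2) ^+ k.+1)%R.
(** The integral over [0, s] of (w(x)/w(s))^{2(k+1)}, with the part depending on s taken out so that
    it can be differentiated as a quotient. *)
Let D (k : nat) s : R := W k s / (w s ^+ 2) ^+ k.+1.

Let cwk (k : nat) x : 0 <= x <= b -> {for x, continuous (fun x =>
  (w x ^+ 2) ^+ k.+1)}.
Proof.
move=> /cw cx; have h : {for x, continuous (fun x =>
  w x ^+ 2)} by exact: (@cvgM R).
have := @exprn_continuous R k.+1 (w x ^+ 2).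
exact: (continuous_comp h).
Qed.

Let iwk (k : nat) s : s <= b -> mu.-integrable `[0, s] (EFin \o (fun x =>
  (w x ^+ 2) ^+ k.+1)).
Proof.
move=> sb; apply: continuous_compact_integrable; first exact: segment_compact.
apply: continuous_in_subspaceT => x; rewrite inE/= in_itv/= => /andP[x0 xs].
by apply: cwk; rewrite x0 (le_trans xs).
Qed.

Let DE (k : nat) s : 0 < s <= b ->
  (\int[mu]_(x in `[0%R, s]) (((w x / w s) ^+ 2) ^+ k.+1)%:E = (D k s)%:E)%E.
Proof.
move=> /[dup] sb /andP[s0 s1].
rewrite /D /W mulrC -RintegralZl//; last exact: iwk.
rewrite /Rintegral fineK; last first.
  apply: integrable_fin_num => //=.
  exact: (integrableZl _ ((w s ^+ 2) ^- k.+1) (iwk k s1)).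
apply: eq_integral => x _; congr (_%:E).
by rewrite expr_div_n expr_div_n mulrC.
Qed.

Let D_ge0 (k : nat) s : 0 < s <= b -> 0 <= D k s.
Proof.
move=> sb; rewrite -lee_fin -DE//; apply: integral_ge0 => x _.
by rewrite lee_fin exprn_ge0 ?sqr_ge0.
Qed.

Let D_le (k : nat) s : 0 < s <= b -> D k s <= s.
Proof.
move=> sb; have /andP[s0 s1] := sb; rewrite -lee_fin -DE//.
apply: (@le_trans _ _ (\int[mu]_(x in `[0%R, s]) (cst 1%:E x))%E).
  apply: ge0_le_integral => //.
  - by move=> x _; rewrite lee_fin exprn_ge0 ?sqr_ge0.
  - apply/measurable_EFinP; do 2 apply: measurable_funX.
    by apply: measurable_funM => //; exact: measurable_funS mw.
  - move=> x /=; rewrite in_itv/= => /andP[x0 xs].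
    have wx : 0 <= w x by apply: w_ge0; rewrite x0 (le_trans xs).
    have ws := w_gt0 sb.
    have wxs : w x <= w s.
      by move: xs; rewrite le_eqVlt => /predU1P[->//|xs]; rewrite ltW// w_incr.
    rewrite lee_fin -exprM expr_le1 ?divr_ge0 ?(ltW ws)//.
    by rewrite ler_pdivrMr// mul1r.
by rewrite integral_cst//= mul1e lebesgue_measure_itv/= lte_fin s0 sube0.
Qed.

Let dW (k : nat) s : 0 < s < b -> is_derive s 1 (W k) ((w s ^+ 2) ^+ k.+1).
Proof.
move=> /andP[s0 sb].
have c : {for s, continuous (fun x => (w x ^+ 2) ^+ k.+1)} by apply: cwk;
  rewrite !ltW.
have [d1 d2] := continuous_FTC1_closed sb (iwk k (lexx b)) s0 c.
by apply: DeriveDef; [exact: d1|rewrite -derive1E].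
Qed.

(** The 1 is the integrand at the moving endpoint x = s; the other term comes from differentiating
    the normalization by w(s). *)
Let dD (k : nat) s : 0 < s < b ->
  is_derive s 1 (D k) (1 - 2 * k.+1%:R * (ld s * D k s)).
Proof.
move=> si; have d1 := dW k si; have d2 := dw si.
have ws : 0 < w s by apply: w_gt0; move: si => /andP[-> /ltW].
have wk : (w s ^+ 2) ^+ k.+1 != 0 by rewrite gt_eqF// !exprn_gt0.
suff : is_derive s 1 (fun s => W k s * ((w s ^+ 2) ^+ k.+1)^-1)
  (1 - 2 * k.+1%:R * (ld s * D k s)) by [].
der; first exact: wk.
rewrite /D /= !(exprS _ k); field.
by apply/andP; split; rewrite gt_eqF//; do ?apply: exprn_gt0.
Qed.

Let cD (k : nat) s : 0 < s < b -> {for s, continuous (D k)}.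
Proof. by move=> /(dD k); exact: is_derive_continuous. Qed.

(** Integrate the differential equation of [D k], with s - D_k(s) as primitive; its limit at 0 is 0
    because 0 <= D_k(s) <= s. *)
Let integral_ldD (k : nat) :
  (\int[mu]_(s in `[0%R, b]) (2 * k.+1%:R * (ld s * D k s))%:E = (b - D k
    b)%:E)%E.
Proof.
rewrite -[RHS](_ : (b - D k b - (0 - 0))%:E = _); last by rewrite !subr0.
have si s : 0 < s < b -> 0 < s <= b by move=> /andP[-> /ltW].
apply: (@ge0_FTC2_oo _ _ (fun s => s - D k s)) => //.
- move=> s sb; have d := dD k sb; apply: (der_eq (derD (der_id s) (derN d)));
    ring.
- move=> s sb; apply: cvgM; first exact: cvg_cst.
  by apply: cvgM; [exact: cld|exact: cD].
- by move=> s sb; rewrite mulr_ge0// mulr_ge0 ?ld0 ?D_ge0 ?si.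
- apply: cvgB; first by apply: cvg_at_right_filter; exact: cvg_id.
  apply: (@squeeze_cvgr _ _ _ _ (cst 0) id).
  + near=> s.
    have h : 0 < s <= b by apply/andP; split; near: s;
      [exact: nbhs_right_gt|exact: nbhs_right_le].
    by rewrite D_ge0// D_le.
  + exact: cvg_cst.
  + by apply: cvg_at_right_filter; exact: cvg_id.
- apply: cvgB; first by apply: cvg_at_left_filter; exact: cvg_id.
  apply: cvgM.
    exact: (parameterized_integral_cvg_at_left b0 (iwk k (lexx b))).
  apply: cvgV; first by rewrite !expf_neq0// gt_eqF// w_gt0// b0 lexx.
  by apply: cvg_at_left_filter; apply: cwk; rewrite lexx ltW.
Unshelve. all: by end_near. Qed.

Let mr s : measurable_fun setT (fun x => (w x / w s) ^+ 2).
Proof. by apply: measurable_funX; apply: measurable_funM. Qed.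

Let sum_D s : 0 < s < b -> (\sum_(k <oo) (D k s / k.+1%:R)%:E = (Lam s)%:E)%E.
Proof.
move=> si; have /andP[s0 s1] := si; have sb : 0 < s <= b by rewrite s0 ltW.
have mrk k : measurable_fun setT (fun x => (((w x / w s) ^+ 2) ^+ k.+1 /
  k.+1%:R)%:E).
  by apply/measurable_EFinP; apply: measurable_funM => //;
    apply: measurable_funX.
(* The endpoint x = s is dropped: there the ratio is 1, the series diverges and the logarithm takes
   its default value. *)
rewrite -LamE// (@integral_itv_bndoo _ 0 s _ true false); last first.
  apply/measurable_EFinP; apply: measurable_funS (_ : measurable_fun setT _) =>
    //.
  apply: measurableT_comp => //; apply: measurableT_comp;
    first exact: measurable_ln.
  by apply: measurable_funB.
transitivity (\int[mu]_(x in `]0%R, s[)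
    \sum_(k <oo) (((w x / w s) ^+ 2) ^+ k.+1 / k.+1%:R)%:E)%E; last first.
  apply: eq_integral => x; rewrite inE/= in_itv/= => /andP[x0 xs].
  rewrite ln_series// sqr_ge0/= expr_lt1// ?divr_ge0 ?w_ge0 ?x0 ?s0 ?(ltW x0)
    ?(ltW s0) ?(ltW s1)//.
    by rewrite ltr_pdivrMr ?w_gt0// mul1r w_incr// ltW.
  by rewrite (le_trans (ltW xs))// ltW.
rewrite integral_nneseries//; last 2 first.
- by move=> k; apply: measurable_funS (mrk k).
- by move=> k x _; rewrite lee_fin divr_ge0// exprn_ge0 ?sqr_ge0.
apply: eq_eseriesr => k _.
rewrite -(@integral_itv_bndoo _ 0 s _ true false);
  last exact: measurable_funS (mrk k).
rewrite mulrC EFinM -DE// -ge0_integralZl//=.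
- by apply: eq_integral => x _; rewrite -EFinM mulrC.
- by apply/measurable_EFinP; apply: measurable_funX;
    exact: measurable_funS (mr s).
- by move=> x _; rewrite lee_fin exprn_ge0 ?sqr_ge0.
Qed.

(** Termwise, the two integrals contribute D_k(b)/(2(k+1)^2) and (b - D_k(b))/(2(k+1)^2). The
    unknown D_k(b) cancels, and b zeta(2)/2 remains. Stating a sum instead of a difference keeps all
    terms nonnegative, so both series may be interchanged with the integral. *)
Lemma integral_dilog_by_parts :
  (\int[mu]_(x in `[0%R, b]) \sum_(k <oo) (((w x / w b) ^+ 2) ^+ k.+1 / (2 *
    k.+1%:R ^+ 2))%:E +
   \int[mu]_(s in `[0%R, b]) (ld s * Lam s)%:E = (b * pi ^+ 2 / 12)%:E)%E.
Proof.
have bb : 0 < b <= b by rewrite b0 lexx.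
have mrk k : measurable_fun setT (fun x => (((w x / w b) ^+ 2) ^+ k.+1 / (2 *
  k.+1%:R ^+ 2))%:E).
  by apply/measurable_EFinP; apply: measurable_funM => //;
    apply: measurable_funX.
have mo (f : R -> R) : (forall x, 0 < x < b -> {for x, continuous f}) ->
    measurable_fun `]0%R, b[ (fun x => (f x)%:E).
  move=> cf; apply/measurable_EFinP; apply: open_continuous_measurable_fun =>
    //.
  by move=> x; rewrite inE/= in_itv/=; exact: cf.
have si s : 0 < s < b -> 0 < s <= b by move=> /andP[-> /ltW].
have k0 (k : nat) : 0 <= 2 * k.+1%:R ^+ 2 :> R by apply: mulr_ge0 => //;
  exact: sqr_ge0.
have -> : (\int[mu]_(x in `[0%R, b]) \sum_(k <oo)
    (((w x / w b) ^+ 2) ^+ k.+1 / (2 * k.+1%:R ^+ 2))%:E =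
    \sum_(k <oo) (D k b / (2 * k.+1%:R ^+ 2))%:E)%E.
  rewrite integral_nneseries//; last 2 first.
  - by move=> k; apply: measurable_funS (mrk k).
  - by move=> k x _; rewrite lee_fin; apply: divr_ge0 => //; apply: exprn_ge0;
      exact: sqr_ge0.
  apply: eq_eseriesr => k _.
  rewrite [in RHS]mulrC EFinM -DE// -ge0_integralZl//=.
  - by apply: eq_integral => x _; rewrite -EFinM mulrC.
  - by apply/measurable_EFinP; apply: measurable_funX;
      exact: measurable_funS (mr b).
  - by move=> x _; rewrite lee_fin exprn_ge0 ?sqr_ge0.
have -> : (\int[mu]_(s in `[0%R, b]) (ld s * Lam s)%:E =
    \sum_(k <oo) ((b - D k b) / (2 * k.+1%:R ^+ 2))%:E)%E.
  rewrite (@integral_itv_bndoo _ 0 b (fun s => (ld s * Lam s)%:E) true false);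
    last first.
    by apply: mo => x xb; apply: cvgM; [exact: cld|exact: cLam].
  transitivity (\int[mu]_(s in `]0%R, b[) \sum_(k <oo) (ld s * (D k s /
    k.+1%:R))%:E)%E.
    apply: eq_integral => s; rewrite inE/= in_itv/= => sb.
    rewrite EFinM -sum_D// -nneseriesZl.
      by apply: eq_eseriesr => k _; rewrite EFinM.
    by move=> k _; rewrite lee_fin divr_ge0// D_ge0// si.
  rewrite integral_nneseries//; last 2 first.
  - move=> k; apply: mo => x xb; apply: cvgM; first exact: cld.
    by apply: cvgM; [exact: cD|exact: cvg_cst].
  - move=> k x; rewrite /= in_itv/= => xb.
    by rewrite lee_fin mulr_ge0 ?ld0// divr_ge0// D_ge0// si.
  apply: eq_eseriesr => k _.
  rewrite [in RHS]mulrC EFinM -integral_ldD (@integral_itv_bndoo _ 0 b _ true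
    false); last first.
    apply: mo => x xb; apply: cvgM; first exact: cvg_cst.
    by apply: cvgM; [exact: cld|exact: cD].
  rewrite -ge0_integralZl//=.
  - apply: eq_integral => x _; rewrite -EFinM; congr (_%:E); field.
    by rewrite nat1r pnatr_eq0.
  - apply: mo => x xb; apply: cvgM; first exact: cvg_cst.
    by apply: cvgM; [exact: cld|exact: cD].
  - move=> x; rewrite /= in_itv/= => xb.
    by rewrite lee_fin mulr_ge0// mulr_ge0 ?ld0// D_ge0// si.
rewrite -nneseriesD; last 2 first.
- by move=> k _ _; rewrite lee_fin; apply: divr_ge0 => //; exact: D_ge0.
- by move=> k _ _; rewrite lee_fin; apply: divr_ge0 => //;
    rewrite subr_ge0 D_le.
transitivity (\sum_(k <oo) ((b / 2)%:E * (1 / k.+1%:R ^+ 2)%:E))%E.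
  apply: eq_eseriesr => k _; rewrite -EFinD -EFinM; congr (_%:E); field.
  by rewrite nat1r pnatr_eq0.
rewrite nneseriesZl; last by move=> k _; rewrite lee_fin divr_ge0 ?sqr_ge0.
by rewrite basel -EFinM; congr (_%:E); field.
Qed.

End dilog_by_parts.

(** * The dilogarithm averages for the two weights, and Q(pi/2) *)

Section dilog_values.
Context {R : realType}.
Local Notation mu := (@lebesgue_measure R).
Local Notation S := (@Slog R).
Local Notation Q := (@Qlog R).
Local Notation KS := (@KSlog R).
Implicit Types x t b z : R.

(** The function D of the overview. Extended real values give it a meaning for every z, so that
    positivity and measurability hold without restriction. *)
Definition half_dilog z : \bar R :=
  (\sum_(k <oo) ((z ^+ 2) ^+ k.+1 / (2 * k.+1%:R ^+ 2))%:E)%E.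

Lemma half_dilog_ge0 z : (0 <= half_dilog z)%E.
Proof.
apply: nneseries_ge0 => k _ _; rewrite lee_fin; apply: divr_ge0.
  by apply: exprn_ge0; exact: sqr_ge0.
by apply: mulr_ge0 => //; exact: sqr_ge0.
Qed.

Lemma half_dilogN z : half_dilog (- z) = half_dilog z.
Proof. by rewrite /half_dilog sqrrN. Qed.

Lemma measurable_half_dilog (f : R -> R) : measurable_fun setT f ->
  measurable_fun setT (fun x => half_dilog (f x)).
Proof.
move=> mf; apply: ge0_emeasurable_sum => [k x _ _|k _].
  rewrite lee_fin; apply: divr_ge0; first by apply: exprn_ge0; exact: sqr_ge0.
  by apply: mulr_ge0 => //; exact: sqr_ge0.
apply/measurable_EFinP; apply: measurable_funM => //.
by do 2 apply: measurable_funX.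
Qed.

(** Each power of z^2 is at most z^2, and the coefficients sum to zeta(2)/2. It controls the average
    as b tends to pi/2. *)
Lemma half_dilog_le z : `|z| <= 1 -> (half_dilog z <= (z ^+ 2 * (pi ^+ 2 /
  12))%:E)%E.
Proof.
move=> z1; rewrite (_ : (_ * _)%:E = \sum_(k <oo) ((z ^+ 2 / 2)%:E * (1 /
  k.+1%:R ^+ 2)%:E))%E; last first.
  rewrite nneseriesZl; last by move=> k _; rewrite lee_fin divr_ge0 ?sqr_ge0.
  by rewrite basel -EFinM; congr (_%:E); field.
apply: lee_nneseries => [k _ _|k _].
  rewrite lee_fin; apply: divr_ge0; first by apply: exprn_ge0; exact: sqr_ge0.
  by apply: mulr_ge0 => //; exact: sqr_ge0.
rewrite -EFinM lee_fin (_ : _ / 2 * _ = z ^+ 2 / (2 * k.+1%:R ^+ 2));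
  last first.
  by field; rewrite nat1r pnatr_eq0.
apply: ler_wpM2r; first by rewrite invr_ge0; apply: mulr_ge0 => //;
  exact: sqr_ge0.
have z2 : z ^+ 2 <= 1 by rewrite -(real_normK (num_real z)) expr_le1.
by rewrite exprS ler_piMr ?sqr_ge0// exprn_ile1// sqr_ge0.
Qed.

Lemma measurable_sin : measurable_fun setT (@sin R).
Proof. by apply: continuous_measurable_fun; exact: continuous_sin. Qed.

Lemma measurable_cos : measurable_fun setT (@cos R).
Proof. by apply: continuous_measurable_fun; exact: continuous_cos. Qed.

Lemma measurable_inv : measurable_fun setT (@GRing.inv R).
Proof.
rewrite (_ : GRing.inv = fun x : R => if x == 0 then 0 else x^-1); last first.
  by apply/funext => x; case: eqP => // ->; rewrite invr0.
apply: measurable_fun_if => //; first exact: measurable_fun_eqr.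
apply: open_continuous_measurable_fun.
  rewrite setTI (_ : _ @^-1` _ = [set x | x != 0]); first exact: open_neq.
  by apply/funext => x /=; apply/propext; split => [->|/negbTE].
by move=> x; rewrite inE/= => -[_ /negbT x0]; exact: inv_continuous.
Qed.

Lemma measurable_cosV : measurable_fun setT (fun x : R => (cos x)^-1).
Proof. by apply: measurableT_comp measurable_cos; exact: measurable_inv. Qed.

Lemma sin_incr x t : 0 <= x -> x < t -> t <= pi / 2 -> sin x < sin t.
Proof.
move=> x0 xt tp; rewrite ltr_sin// in_itv/=; apply/andP; lra.
Qed.

Lemma cos_decr x t : 0 <= x -> x < t -> t <= pi -> cos t < cos x.
Proof.
move=> x0 xt tp; rewrite ltr_cos// in_itv/=; apply/andP; lra.
Qed.

Lemma ln_compl_sqr_ge0 z : 0 <= - ln (1 - z ^+ 2).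
Proof. by rewrite oppr_ge0 ln_le0// gerBl sqr_ge0. Qed.

(** Integration by parts with w = 1/cos, so [ld] is the tangent and [Lam] is -2 S. The function 2
    [lcos] S - 2 [KSlog] is a primitive of their product, since [KSlog] absorbs the term
    [lsin * lcos]. *)
Lemma integral_half_dilog_cos b : 0 < b < pi / 2 ->
  (\int[mu]_(x in `[0%R, b]) half_dilog (cos b / cos x) =
   (b * pi ^+ 2 / 12 - 2 * lcos b * S b + 2 * KS b)%:E)%E.
Proof.
move=> bi; have /andP[b0 b1] := bi.
have sub t : 0 < t < b -> 0 < t < pi / 2 by move=> /andP[? ?]; apply/andP; lra.
have cpos t : 0 <= t <= b -> 0 < cos t.
  move=> /andP[t0 tb]; apply: cos_gt0_pihalf; apply/andP; lra.
have wE s x : (cos x)^-1 / (cos s)^-1 = cos s / cos x by rewrite invrK mulrC.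
(* The sign of S comes for free: -2 S(t) is the integral of a nonnegative function. *)
have S0 t : 0 < t < pi / 2 -> 0 <= -2 * S t.
  move=> ti; rewrite -lee_fin -integral_ln_cos//; apply: integral_ge0 => x _.
  by rewrite lee_fin ln_compl_sqr_ge0.
have ctan t : 0 < t < pi / 2 -> {for t, continuous (fun t => sin t / cos t)}.
  move=> /cos_gt0_oo c0; have [d hd] : exists d, is_derive t 1 (fun t =>
    sin t / cos t) d.
    by eexists; repeat (der_step; cbv beta); rewrite gt_eqF.
  exact: is_derive_continuous hd.
have cS t : 0 < t < pi / 2 -> {for t, continuous (fun t => -2 * S t)}.
  move=> /itv_pihalf_pi/der_Slog dS; apply: cvgM; first exact: cvg_cst.
  exact: is_derive_continuous dS.
have H : (\int[mu]_(x in `[0%R, b]) half_dilog ((cos x)^-1 / (cos b)^-1) +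
    \int[mu]_(s in `[0%R, b]) (sin s / cos s * (-2 * S s))%:E = (b * pi ^+ 2 /
      12)%:E)%E.
  apply: (@integral_dilog_by_parts R (fun x => (cos x)^-1) (fun x =>
    sin x / cos x)
    (fun s => -2 * S s)) => //; first exact: measurable_cosV.
  - move=> x /cpos c0; apply: cvgV; first by rewrite gt_eqF.
    exact: continuous_cos.
  - move=> x /sub/cos_gt0_oo c0; der; first by rewrite gt_eqF.
    by field; rewrite gt_eqF.
  - by rewrite cos0 invr1.
  - move=> x t x0 xt tb.
    rewrite ltf_pV2 ?posrE ?cpos ?x0 ?(le_trans x0 (ltW xt))//.
      by apply: cos_decr => //; lra.
    by rewrite (le_trans (ltW xt)).
  - move=> x /sub xi; rewrite divr_ge0 ?(ltW (cos_gt0_oo xi))//.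
    by rewrite ltW// sin_gt0_pi// itv_pihalf_pi.
  - by move=> x /sub; exact: ctan.
  - by move=> x /sub; exact: cS.
  - move=> s /sub si; rewrite -integral_ln_cos//; apply: eq_integral => x _.
    by rewrite wE.
move: H; have -> : (\int[mu]_(s in `[0%R, b]) (sin s / cos s * (-2 * S s))%:E =
    (2 * lcos b * S b - 2 * KS b - (2 * lcos 0 * 0 - 2 * 0))%:E)%E.
  have dF t : 0 < t < pi / 2 -> is_derive t 1 (fun t =>
    2 * lcos t * S t - 2 * KS t) (sin t / cos t * (-2 * S t)).
    move=> ti; have d1 := der_lcos ti; have d2 := der_Slog (itv_pihalf_pi ti);
      have d3 := der_KSlog ti.
    by der; ring.
  apply: (@ge0_FTC2_oo _ _ (fun t => 2 * lcos t * S t - 2 * KS t)) => //.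
  - by move=> x /sub; exact: dF.
  - by move=> x /sub xi; apply: cvgM; [exact: ctan|exact: cS].
  - move=> x /sub xi; apply: mulr_ge0; last exact: S0.
    by rewrite divr_ge0 ?(ltW (cos_gt0_oo xi))// ltW// sin_gt0_pi//
      itv_pihalf_pi.
  - apply: cvgB; last by apply: cvgM; [exact: cvg_cst|exact: KSlog_cvg0].
    apply: cvgM; last exact: Slog_cvg0.
    apply: cvgM; first exact: cvg_cst.
    have : is_derive (0 : R) 1 lcos 0.
      rewrite /lcos; der; first by rewrite cos0; lra.
      by rewrite cos0 sin0; ring.
    exact: is_derive_cvg_right.
  - exact: is_derive_cvg_left (dF _ bi).
under eq_integral do rewrite wE.
move=> /(congr1 (fun e => e - (2 * lcos b * S b - 2 * KS b - (2 * lcos 0 * 0 - 2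
  * 0))%:E))%E.
rewrite addeK// => ->; rewrite -EFinB; congr (_%:E); ring.
Qed.

(** Integration by parts with w = sin, so [ld] is the cotangent and [Lam] is the value found in
    [integral_ln_sin]. *)
Lemma integral_half_dilog_sin b : 0 < b < pi / 2 ->
  (\int[mu]_(x in `[0%R, b]) half_dilog (sin x / sin b) =
   (b * pi ^+ 2 / 12 - (b * lsin b ^+ 2 - S (2 * b) * lsin b + Q b + 2 * KS
     b))%:E)%E.
Proof.
move=> bi; have /andP[b0 b1] := bi.
have sub t : 0 < t < b -> 0 < t < pi / 2 by move=> /andP[? ?]; apply/andP; lra.
have L0 t : 0 < t < pi / 2 -> 0 <= 2 * t * lsin t - S (2 * t).
  move=> ti; rewrite -lee_fin -integral_ln_sin//; apply: integral_ge0 => x _.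
  by rewrite lee_fin ln_compl_sqr_ge0.
have spos t : 0 < t < pi / 2 -> 0 < sin t by move=> /itv_pihalf_pi;
  exact: sin_gt0_pi.
have ccot t : 0 < t < pi / 2 -> {for t, continuous (fun t => cos t / sin t)}.
  move=> /spos c0; have [d hd] : exists d, is_derive t 1 (fun t =>
    cos t / sin t) d.
    by eexists; repeat (der_step; cbv beta); rewrite gt_eqF.
  exact: is_derive_continuous hd.
have dS2 t : 0 < t < pi / 2 -> is_derive t 1 (fun t =>
  S (2 * t)) (2 * lsin (2 * t)).
  move=> /andP[t0 t1]; have h : is_derive (2 * t + 0) 1 S (lsin (2 * t)).
    by rewrite addr0; apply: der_Slog; apply/andP; lra.
  have := der_comp_affine h; rewrite (_ : (fun t => S (2 * t + 0)) = (fun t =>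
    S (2 * t)))//.
  by apply/funext => u; rewrite addr0.
have cL t : 0 < t < pi / 2 -> {for t, continuous (fun t =>
  2 * t * lsin t - S (2 * t))}.
  move=> ti; have d1 := der_lsin (itv_pihalf_pi ti); have d2 := dS2 _ ti.
  apply: cvgB; last exact: is_derive_continuous d2.
  apply: cvgM; last exact: is_derive_continuous d1.
  by apply: cvgM; [exact: cvg_cst|exact: cvg_id].
have H : (\int[mu]_(x in `[0%R, b]) half_dilog (sin x / sin b) +
    \int[mu]_(s in `[0%R, b]) (cos s / sin s * (2 * s * lsin s - S (2 * s)))%:E
      = (b * pi ^+ 2 / 12)%:E)%E.
  apply: (@integral_dilog_by_parts R sin (fun x => cos x / sin x)
    (fun s => 2 * s * lsin s - S (2 * s))) => //; first exact: measurable_sin.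
  - by move=> x _; exact: continuous_sin.
  - move=> x /sub/spos s0; apply: (der_eq (is_derive_sin x)).
    by field; rewrite gt_eqF.
  - by rewrite sin0.
  - by move=> x t x0 xt tb; apply: sin_incr => //; lra.
  - move=> x /sub xi; rewrite divr_ge0 ?(ltW (spos _ xi))//.
    by rewrite ltW// cos_gt0_oo.
  - by move=> x /sub; exact: ccot.
  - by move=> x /sub; exact: cL.
  - by move=> s /sub si; rewrite -integral_ln_sin.
(* The first two terms produce the integrand plus [lsin t ^+ 2 - 2 * lsin (2 * t) * lsin t]; by the
   duplication of [lsin], the terms [Q t + 2 * KS t] compensate this excess. *)
pose F t := t * lsin t ^+ 2 - S (2 * t) * lsin t + Q t + 2 * KS t.
have dF t : 0 < t < pi / 2 -> is_derive t 1 F (cos t / sin t * (2 * t * lsin t -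
  S (2 * t))).
  move=> ti; have d1 := der_lsin (itv_pihalf_pi ti); have d2 := dS2 _ ti.
  have d3 := der_KSlog ti; have d4 := der_Qlog (itv_pihalf_pi ti).
  have d5 := derM d2 d1.
  have d6 : is_derive t 1 (fun t => t * lsin t ^+ 2) (lsin t ^+ 2 + t * (2 *
    lsin t * (cos t / sin t))) by der => /=; ring.
  have := derD (derD (derB d6 d5) d4) (derM (der_cst t 2) d3).
  by move=> h; apply: (der_eq h); rewrite lsin_double//; ring.
move: H; have -> : (\int[mu]_(s in `[0%R, b]) (cos s / sin s * (2 * s * lsin s -
  S (2 * s)))%:E =
    (F b - (0 - 0 + 0 + 2 * 0))%:E)%E.
  apply: (@ge0_FTC2_oo _ _ F) => //.
  - by move=> x /sub; exact: dF.
  - by move=> x /sub xi; apply: cvgM; [exact: ccot|exact: cL].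
  - move=> x /sub xi; apply: mulr_ge0; last exact: L0.
    by rewrite divr_ge0 ?(ltW (spos _ xi))// ltW// cos_gt0_oo.
  - apply: cvgD; last by apply: cvgM; [exact: cvg_cst|exact: KSlog_cvg0].
    apply: cvgD; last exact: Qlog_cvg0.
    apply: cvgB; first exact: mul_lsin2_cvg0.
    by under eq_cvg do rewrite -[2 * _]addr0; exact: Slog_double_lsin_cvg0.
  - exact: is_derive_cvg_left (dF _ bi).
move=> /(congr1 (fun e => e - (F b - (0 - 0 + 0 + 2 * 0))%:E))%E.
rewrite addeK// => ->; rewrite -EFinB; congr (_%:E); rewrite /F; ring.
Qed.

(** The average of D(cos b / cos x) over [0, b] is squeezed to 0 as b tends to pi/2, whereas its
    closed form tends to pi^3/24 - Q(pi/2). *)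
Lemma Qlog_pihalf : Q (pi / 2) = pi ^+ 3 / 24.
Proof.
pose f b := b * pi ^+ 2 / 12 - 2 * lcos b * S b + 2 * KS b.
have f0 b : 0 < b < pi / 2 -> 0 <= f b <= pi ^+ 2 / 12 * (sin b * cos b).
  move=> bi; have /andP[b0 b1] := bi.
  have cpos t : 0 <= t <= b -> 0 < cos t.
    by move=> /andP[t0 tb]; apply: cos_gt0_pihalf; apply/andP; lra.
  rewrite -!lee_fin -integral_half_dilog_cos//; apply/andP; split.
    by apply: integral_ge0 => x _; exact: half_dilog_ge0.
  have sub t : 0 < t < b -> 0 < t < pi / 2 by move=> /andP[? ?]; apply/andP;
    lra.
  (* The majorant from [half_dilog_le]; its primitive is a multiple of the tangent, which yields the
     factor sin b cos b. *)
  pose g x := pi ^+ 2 / 12 * cos b ^+ 2 / cos x ^+ 2.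
  have dG t : 0 <= t <= b -> is_derive t 1 (fun t =>
    pi ^+ 2 / 12 * cos b ^+ 2 * (sin t / cos t)) (g t).
    move=> /cpos c0; der; first by rewrite gt_eqF.
    have := cos2Dsin2 t => e; rewrite /g.
    transitivity (pi ^+ 2 / 12 * cos b ^+ 2 * (cos t ^+ 2 + sin t ^+ 2) / cos t
      ^+ 2).
      by generalize (pi : R) => p; field; rewrite gt_eqF.
    by rewrite e mulr1.
  have -> : ((pi ^+ 2 / 12 * (sin b * cos b))%:E = \int[mu]_(x in `[0%R,
    b]) (g x)%:E)%E.
    pose G t := pi ^+ 2 / 12 * cos b ^+ 2 * (sin t / cos t).
    have e : pi ^+ 2 / 12 * (sin b * cos b) = G b - G 0.
      rewrite /G sin0 mul0r mulr0 subr0; have := cpos b;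
        rewrite lexx (ltW b0) => /(_ isT) c0.
      by generalize (pi : R) => p; field; rewrite gt_eqF.
    rewrite e; apply/esym; apply: (@ge0_FTC2_oo _ g G); first exact: b0.
    - by move=> x /andP[x0 x1]; apply: dG; rewrite !ltW.
    - move=> x /andP[x0 x1]; have c0 : 0 < cos x by apply: cpos; rewrite !ltW.
      have [d hd] : exists d, is_derive x 1 g d.
        by rewrite /g; eexists; repeat (der_step; cbv beta);
          rewrite gt_eqF// exprn_gt0.
      exact: is_derive_continuous hd.
    - move=> x _; rewrite /g; apply: divr_ge0; last exact: sqr_ge0.
      by rewrite mulr_ge0 ?sqr_ge0// divr_ge0 ?sqr_ge0.
    - by apply: is_derive_cvg_right (dG 0 _); rewrite lexx ltW.
    - by apply: is_derive_cvg_left (dG b _); rewrite lexx ltW.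
  apply: ge0_le_integral => //.
  - by move=> x _; exact: half_dilog_ge0.
  - apply: measurable_funS (measurable_half_dilog _) => //.
    by apply: measurable_funM => //; exact: measurable_cosV.
  - apply/measurable_EFinP; apply: measurable_funM => //.
    apply: measurable_funTS; apply: (measurableT_comp measurable_inv).
    by apply: measurable_funX; exact: measurable_cos.
  - move=> x /=; rewrite in_itv/= => xi; have /andP[x0 xb] := xi.
    have c0 := cpos _ xi; have cb : 0 < cos b by apply: cpos; rewrite lexx ltW.
    apply: (le_trans (half_dilog_le _)).
      rewrite ger0_norm ?divr_ge0 ?(ltW c0) ?(ltW cb)// ler_pdivrMr// mul1r.
      move: xb; rewrite le_eqVlt => /predU1P[->//|xb].
      by rewrite ltW// cos_decr//; lra.
    rewrite lee_fin /g expr_div_n; rewrite le_eqVlt; apply/orP; left; apply/eqP;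
      generalize (pi : R) => p.
    by field; rewrite gt_eqF.
have fc : f b @[b --> (pi / 2 : R)^'-] --> pi / 2 * pi ^+ 2 / 12 - 2 * 0 + 2 *
  (- Q (pi / 2) / 2).
  apply: cvgD; last by apply: cvgM; [exact: cvg_cst|exact: KSlog_cvg_pihalf].
  apply: cvgB.
    apply: cvgM; last exact: cvg_cst.
    apply: cvgM; last exact: cvg_cst.
    by apply: cvg_at_left_filter; exact: cvg_id.
  rewrite (_ : (fun b => _) = (fun b => 2 * (S b * lcos b)));
    last by apply/funext => b; ring.
  by apply: cvgM; [exact: cvg_cst|exact: Slog_lcos_cvg_pihalf].
have f0c : f b @[b --> (pi / 2 : R)^'-] --> (0 : R).
  apply: (@squeeze_cvgr _ _ _ _ (cst 0) (fun b =>
    pi ^+ 2 / 12 * (sin b * cos b))).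
  - near=> b; apply: f0; apply/andP; split; near: b; last exact: nbhs_left_lt.
    by apply: nbhs_left_gt; exact: pihalf_gt0.
  - exact: cvg_cst.
  - rewrite -[X in _ --> X](mulr0 (pi ^+ 2 / 12)); apply: cvgM;
      first exact: cvg_cst.
    rewrite -[X in _ --> X](_ : sin (pi / 2) * cos (pi / 2) = 0);
      last by rewrite cos_pihalf mulr0.
    by apply: cvgM; apply: cvg_at_left_filter;
      [exact: continuous_sin|exact: continuous_cos].
have := cvg_unique _ fc f0c => /(_ (@Rhausdorff R)) e.
suff : pi ^+ 3 / 24 - Q (pi / 2) = 0 by lra.
by rewrite -[RHS]e; generalize (pi : R) (Q (pi / 2)) => p q; field.
Unshelve. all: by end_near. Qed.

End dilog_values.

(** * Mahler measures *)

Section mahler.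
Context {R : realType}.
Local Notation mu := (@lebesgue_measure R).
Local Notation S := (@Slog R).
Local Notation Q := (@Qlog R).
Local Notation KS := (@KSlog R).
Implicit Types x t u a b : R.

(** From sin(2 pi/3) = sin(pi/3), expand the left side and cancel the sine. *)
Lemma cos_pi_div3 : cos (pi / 3 : R) = 1 / 2.
Proof.
have p0 := pi_gt0 R.
have s0 : 0 < sin (pi / 3 : R) by apply: sin_gt0_pi; apply/andP; lra.
have : sin (2 * (pi / 3 : R)) = sin (pi / 3).
  by rewrite -[RHS]sin_piB; congr sin; field.
rewrite sin_double => h; apply: (@mulfI _ (2 * sin (pi / 3)));
  first by rewrite gt_eqF ?mulr_gt0.
by rewrite h; field.
Qed.

Lemma sin_pi_div6 : sin (pi / 6 : R) = 1 / 2.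
Proof. by rewrite -cos_pi_div3 -cos_pihalfB; congr cos; field. Qed.

Lemma lcos_pi_div3 : lcos (pi / 3 : R) = 0.
Proof. by rewrite /lcos cos_pi_div3 (_ : 2 * (1 / 2) = 1) ?ln1//; field. Qed.

Lemma lsin_pi_div6 : lsin (pi / 6 : R) = 0.
Proof. by rewrite /lsin sin_pi_div6 (_ : 2 * (1 / 2) = 1) ?ln1//; field. Qed.

(** The substitution x = pi u gives 1/pi and the symmetry about pi/2 the factor 2. Agreement of [G]
    with [h] is asked only off |2 cos(pi u)| = 1, where the circle means are not computed. *)
Lemma integral_circle_fold (h G : R -> \bar R) :
  measurable_fun setT h -> (forall x, 0 <= h x)%E ->
    (forall x, h (pi - x) = h x) ->
  (forall u, 0 <= u <= 1 -> `|2 * cos (pi * u)| != 1 -> G u = h (pi * u)) ->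
  (\int[mu]_(u in `[0%R, 1%R]) G u =
   (2 / pi)%:E * \int[mu]_(x in `[0%R, (pi / 2)%R]) h x)%E.
Proof.
move=> mh h0 hpi Gh; have p0 := pi_gt0 R.
have mhp : measurable_fun setT (fun u => h (pi * u)).
  by apply: measurableT_comp => //; exact: measurable_funM.
(* Within [0, 1] the exceptional points are u = 1/3 and u = 2/3. Patching [h] there gives a function
   equal to [G] everywhere on [0, 1] whose measurability follows from that of [h] alone. *)
pose G' u := if u == 1 / 3 then G (1 / 3) else if u == 2 / 3 then G (2 / 3) else
  h (pi * u).
have GG' u : 0 <= u <= 1 -> G u = G' u.
  move=> u01; rewrite /G'; case: eqP => [->//|u1]; case: eqP => [->//|u2].
  apply: Gh => //; have /andP[u0 u11] := u01.
  have up : pi * u \in `[0, pi].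
    by rewrite in_itv/= mulr_ge0 ?(ltW p0)//= ler_piMr// ltW.
  have injc v : v \in `[0, pi] -> cos (pi * u) = cos v -> u = v / pi.
    by move=> vi /(cos_inj up vi) <-; rewrite mulrC mulKf// gt_eqF.
  have p3 : (pi / 3 : R) \in `[0, pi] by rewrite in_itv/=; apply/andP; lra.
  have p23 : (pi - pi / 3 : R) \in `[0, pi] by rewrite in_itv/=; apply/andP;
    lra.
  apply/eqP => c1; have [c|c] := leP 0 (2 * cos (pi * u)).
    apply: u1; rewrite (injc _ p3).
      by rewrite mulrAC divff ?gt_eqF.
    by rewrite cos_pi_div3; move: c1; rewrite ger0_norm//; lra.
  apply: u2; rewrite (injc _ p23).
    by generalize (pi : R) p0 => p p0'; field; rewrite gt_eqF.
  by rewrite cosB cospi sinpi cos_pi_div3; move: c1; rewrite ltr0_norm//; lra.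
have mG' : measurable_fun setT G'.
  by apply: measurable_fun_ifT => //; [exact: measurable_fun_eqr|
    apply: measurable_fun_ifT => //; exact: measurable_fun_eqr].
transitivity (\int[mu]_(u in `[0%R, 1%R]) G' u)%E.
  by apply: eq_integral => u; rewrite inE/= in_itv/=; exact: GG'.
transitivity (\int[mu]_(u in `[0%R, 1%R]) h (pi * u)%R)%E.
  apply: ae_eq_integral => //; try exact: measurable_funTS.
  have : mu [set 1 / 3; 2 / 3] = 0%E.
    by apply: countable_lebesgue_measure0; exact: finite_set_countable.
  exists [set 1 / 3; 2 / 3]; split => //.
    by apply: measurableU; exact: measurable_set1.
  move=> u /= /not_implyP[_]; rewrite /G'; case: eqP => [->|_]; first by left.
  by case: eqP => [->|//]; right.
have : (\int[mu]_(x in `[0%R, pi]) h x = pi%:E * \int[mu]_(u in `[0%R,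
  1%R]) h (pi * u)%R)%E.
  rewrite (@ge0_integral_affine _ pi 0) ?gt_eqF//.
  rewrite gtr0_norm// (_ : _ @^-1` _ = `[0, 1]%classic).
    by congr (_ * _)%E; apply: eq_integral => x _; rewrite addr0.
  apply/funext => x; rewrite /= !in_itv/= addr0.
  by rewrite pmulr_rge0// -ler_pdivlMl// mulVf// gt_eqF.
have : (\int[mu]_(x in `[(pi / 2)%R, pi]) h x = \int[mu]_(x in `[0%R,
  (pi / 2)%R]) h x)%E.
  rewrite (@ge0_integral_affine _ (-1) pi) ?oppr_eq0//.
  rewrite normrN1 mul1e (_ : _ @^-1` _ = `[0, pi / 2]%classic).
    by apply: eq_integral => x _; rewrite mulN1r addrC hpi.
  by apply/funext => x; rewrite /= !in_itv/=; apply/propext;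
    split => /andP[? ?]; apply/andP; lra.
rewrite (@ge0_integral_itv_split _ 0 (pi / 2) pi)//; last by apply/andP; lra.
move=> ->; set I := (\int[mu]_(x in `[0%R, _]) _)%E;
  set J := (\int[mu]_(x in _) _)%E.
move=> e; rewrite -[LHS]mul1e (_ : 1%E = (pi^-1)%:E * pi%:E)%E; last first.
  by rewrite -EFinM mulVf// gt_eqF.
rewrite -muleA -e -[(I + I)%E](_ : 2%:E * I = _)%E;
  last by rewrite -mule2n mule_natl.
by rewrite muleA -EFinM mulrC.
Qed.

Lemma cos_double x : cos (2 * x) = 2 * cos x ^+ 2 - 1.
Proof. by rewrite mulr_natl cos_mulr2n mulr2n; ring. Qed.

(** Since 1 + e^{2 i phi} = 2 cos(phi) e^{i phi} with phi = pi u, factoring out e^{i phi} leaves |1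
    + 2 cos(phi) e^{i(2 pi t - phi)}|; the minus sign matches the convention |1 - a e^{ix}| of
    [logq]. *)
Lemma ln_normc_logq t u :
  ln (ComplexField.Normc.normc (1 + expi (2 * pi * t) + expi (2 * pi * u))) =
  logq (- (2 * cos (pi * u))) (2 * pi * t - pi * u).
Proof.
rewrite /expi /=.
rewrite (_ : Num.sqrt _ = Num.sqrt (1 - 2 * (- (2 * cos (pi * u))) * cos (2 * pi
  * t - pi * u) + (- (2 * cos (pi * u))) ^+ 2)); last first.
  congr Num.sqrt.
  rewrite (_ : 2 * pi * u = 2 * (pi * u)); last by ring.
  rewrite sin_double cos_double.
  set A := 2 * pi * t; set p := pi * u; rewrite cosB.
  have := cos2Dsin2 A; have := cos2Dsin2 p => hp hA.
  have e1 : sin A ^+ 2 = 1 - cos A ^+ 2 by lra.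
  have e2 : sin p ^+ 2 = 1 - cos p ^+ 2 by lra.
  transitivity ((cos A + 2 * cos p ^+ 2) ^+ 2 + (sin A + 2 * sin p * cos p) ^+
    2).
    by congr (_ ^+ 2 + _ ^+ 2); [ring|rewrite add0r].
  transitivity (cos A ^+ 2 + sin A ^+ 2 + 4 * cos p ^+ 2 * cos A + 4 * sin p *
    cos p * sin A
    + 4 * cos p ^+ 4 + 4 * sin p ^+ 2 * cos p ^+ 2); first by ring.
  by rewrite e1 e2; ring.
rewrite /logq; set y := 1 - _ + _.
have : 0 <= y.
  rewrite /y; set a := - (2 * cos (pi * u)); set z := 2 * pi * t - pi * u.
  have e : a ^+ 2 = a ^+ 2 * (cos z ^+ 2 + sin z ^+ 2) by rewrite cos2Dsin2
    mulr1.
  rewrite e (_ : _ + _ = (1 - a * cos z) ^+ 2 + (a * sin z) ^+ 2); last by ring.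
  by rewrite addr_ge0 ?sqr_ge0.
(* When the modulus vanishes, both sides are 0 by the convention on the logarithm. *)
rewrite le_eqVlt => /predU1P[<-|y0]; first by rewrite sqrtr0 ln0// mul0r.
have s0 : 0 < Num.sqrt y by rewrite sqrtr_gt0.
rewrite -[in RHS](sqr_sqrtr (ltW y0)) lnXn//.
by rewrite -[ln _ *+ 2]mulr_natl; field.
Qed.

(** |1 - a e^{ix}| = |a| |1 - e^{ix}/a| for real nonzero a, which moves the parameter inside the
    unit disc, where the expansion converges. *)
Lemma logq_inv a x : 1 < `|a| -> logq a x = ln `|a| + logq a^-1 x.
Proof.
move=> a1; have a0 : a != 0 by rewrite -normr_gt0 (lt_trans _ a1).
have n0 : 0 < `|a| by rewrite normr_gt0.
have ai : `|a^-1| < 1 by rewrite normfV invf_lt1.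
have q0 := quad_gt0 x ai.
rewrite /logq (_ : 1 - 2 * a * cos x + a ^+ 2 = `|a| ^+ 2 * (1 - 2 * a^-1 * cos
  x + a^-1 ^+ 2)).
  by rewrite lnM ?posrE ?exprn_gt0// lnXn// -[ln _ *+ 2]mulr_natl; field.
by rewrite real_normK ?num_real//; field.
Qed.

Definition mean1 x : \bar R :=
  if 1 < `|2 * cos x| then (ln `|2 * cos x|)%:E else 0%E.

(** At |2 cos x| = 1 the two branches agree, since the logarithm is 0 and 2 cos x is its own
    inverse; hence either formula may be used up to and including x = pi/3. *)
Definition mean2 x : \bar R :=
  if 1 < `|2 * cos x| then ((ln `|2 * cos x| ^+ 2)%:E + half_dilog (2 * cos
    x)^-1)%E
  else half_dilog (2 * cos x).

Let inner n u := (\int[mu]_(t in `[0%R, 1%R])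
  (ln (ComplexField.Normc.normc (1 + expi (2 * pi * t) + expi (2 * pi * u))) ^+
    n)%:E)%E.

Let norm_lt1 u : `|2 * cos (pi * u)| != 1 -> (1 < `|2 * cos (pi * u)|) = false
  -> `|2 * cos (pi * u)| < 1.
Proof. by move=> n1 /negbT; rewrite -leNgt le_eqVlt (negbTE n1). Qed.

Lemma inner1E u : `|2 * cos (pi * u)| != 1 -> inner 1 u = mean1 (pi * u).
Proof.
move=> n1; rewrite /inner /mean1; under eq_integral do rewrite expr1
  ln_normc_logq.
case: ifPn => [a1|/negbTE/(norm_lt1 n1) a1].
  under eq_integral do rewrite logq_inv ?normrN//.
  by apply: mean_logq; rewrite normfV normrN invf_lt1// (lt_trans _ a1).
under eq_integral do rewrite -[logq _ _]add0r.
by apply: mean_logq; rewrite normrN.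
Qed.

Lemma inner2E u : `|2 * cos (pi * u)| != 1 -> inner 2 u = mean2 (pi * u).
Proof.
move=> n1; rewrite /inner /mean2; under eq_integral do rewrite ln_normc_logq.
case: ifPn => [a1|/negbTE/(norm_lt1 n1) a1].
  under eq_integral do rewrite logq_inv ?normrN//.
  rewrite mean_logq2; last by rewrite normfV normrN invf_lt1// (lt_trans _ a1).
  by rewrite -/(half_dilog _) invrN half_dilogN.
under eq_integral do rewrite -[logq _ _]add0r.
rewrite mean_logq2 ?normrN//.
by rewrite -/(half_dilog _) half_dilogN expr0n/= add0e.
Qed.

Let mcos2 : measurable_fun setT (fun x => 2 * cos x).
Proof. by apply: measurable_funM => //; exact: measurable_cos. Qed.

Let mnorm2 : measurable_fun setT (fun x => `|2 * cos x|).
Proof. by apply: measurableT_comp => //; exact: measurable_normr. Qed.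

Let mlnnorm : measurable_fun setT (fun x => ln `|2 * cos x|).
Proof. by apply: measurableT_comp => //; exact: measurable_ln. Qed.

Lemma measurable_mean1 : measurable_fun setT mean1.
Proof.
apply: measurable_fun_ifT => //; first exact: measurable_fun_ltr.
exact/measurable_EFinP.
Qed.

Lemma measurable_mean2 : measurable_fun setT mean2.
Proof.
apply: measurable_fun_ifT; first exact: measurable_fun_ltr.
  apply: emeasurable_funD; first by apply/measurable_EFinP;
    exact: measurable_funX.
  by apply: measurable_half_dilog; apply: measurableT_comp => //;
    exact: measurable_inv.
exact: measurable_half_dilog.
Qed.

Lemma mean1_ge0 x : (0 <= mean1 x)%E.
Proof. by rewrite /mean1; case: ifPn => // h; rewrite lee_fin ln_ge0// ltW. Qed.

Lemma mean2_ge0 x : (0 <= mean2 x)%E.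
Proof.
rewrite /mean2; case: ifPn => // h; last exact: half_dilog_ge0.
by apply: adde_ge0; [rewrite lee_fin sqr_ge0|exact: half_dilog_ge0].
Qed.

Let cos_piB x : cos (pi - x) = - cos x.
Proof. by rewrite cosB cospi sinpi; ring. Qed.

Lemma mean1_piB x : mean1 (pi - x) = mean1 x.
Proof. by rewrite /mean1 cos_piB mulrN normrN. Qed.

Lemma mean2_piB x : mean2 (pi - x) = mean2 x.
Proof. by rewrite /mean2 cos_piB mulrN normrN invrN !half_dilogN. Qed.

Let cos_ge x : 0 <= x <= pi / 3 -> 1 <= 2 * cos x.
Proof.
move=> /andP[x0]; have p0 := pi_gt0 R; rewrite le_eqVlt => /predU1P[->|x1].
  by rewrite cos_pi_div3; lra.
by have := @cos_decr _ x (pi / 3) x0 x1; rewrite cos_pi_div3 => /(_ ltac:(lra));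
  lra.
Qed.

Let cos_le x : pi / 3 <= x <= pi / 2 -> 0 <= 2 * cos x <= 1.
Proof.
have p0 := pi_gt0 R; move=> /andP[x0 x1].
have c0 : 0 <= cos x by apply: cos_ge0_pihalf; apply/andP; lra.
rewrite mulr_ge0//=; move: x0; rewrite le_eqVlt => /predU1P[<-|x0].
  by rewrite cos_pi_div3; lra.
by have := @cos_decr _ (pi / 3) x ltac:(lra) x0;
  rewrite cos_pi_div3 => /(_ ltac:(lra)); lra.
Qed.

Let mean1_low x : 0 <= x <= pi / 3 -> mean1 x = (lcos x)%:E.
Proof.
move=> /cos_ge c1; rewrite /mean1 ger0_norm ?(le_trans _ c1)// -/(lcos x).
by case: ifPn => // /negbTE h; rewrite /lcos (_ : 2 * cos x = 1) ?ln1//; lra.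
Qed.

Let mean1_high x : pi / 3 <= x <= pi / 2 -> mean1 x = 0%E.
Proof. by move=> /cos_le /andP[c0 c1]; rewrite /mean1 ger0_norm// ltNge c1. Qed.

Let mean2_low x : 0 <= x <= pi / 3 ->
  mean2 x = ((lcos x ^+ 2)%:E + half_dilog (cos (pi / 3) / cos x))%E.
Proof.
move=> /cos_ge c1; rewrite /mean2 ger0_norm ?(le_trans _ c1)// -/(lcos x)
  cos_pi_div3.
have c0 : 0 < cos x by lra.
rewrite (_ : 1 / 2 / cos x = (2 * cos x)^-1); last by field; rewrite gt_eqF.
case: ifPn => // /negbTE h; rewrite /lcos (_ : 2 * cos x = 1) ?ln1//;
  last by lra.
by rewrite expr0n/= add0e invr1.
Qed.

Let mean2_high x : pi / 3 <= x <= pi / 2 -> mean2 x = half_dilog (2 * cos x).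
Proof. by move=> /cos_le /andP[c0 c1]; rewrite /mean2 ger0_norm// ltNge c1. Qed.

Let pi3 : 0 < (pi / 3 : R) < pi / 2.
Proof. by have := pi_gt0 R => p; apply/andP; lra. Qed.

Let pi6 : 0 < (pi / 6 : R) < pi / 2.
Proof. by have := pi_gt0 R => p; apply/andP; lra. Qed.

Let primitive_pihalfB (F f : R -> R) x :
  is_derive (-1 * x + pi / 2) 1 F (f (-1 * x + pi / 2)) ->
  is_derive x 1 (fun x => - F (-1 * x + pi / 2)) (f (pi / 2 - x)).
Proof.
move=> h; apply: (der_eq (derN (der_comp_affine h))).
by rewrite (_ : -1 * x + pi / 2 = pi / 2 - x); ring.
Qed.

(** Only [0, pi/3] contributes. There -S(pi/2 - x) is a primitive of [lcos], and its value at 0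
    disappears because S(pi/2) = 0. *)
Lemma integral_mean1 :
  (\int[mu]_(x in `[0%R, (pi / 2)%R]) mean1 x = (- S (pi / 6))%:E)%E.
Proof.
have p0 := pi_gt0 R.
rewrite (@ge0_integral_itv_split _ 0 (pi / 3)) //; last 3 first.
- by apply/andP; lra.
- exact: measurable_mean1.
- exact: mean1_ge0.
rewrite [X in (_ + X)%E](_ : _ = 0%E); last first.
  by apply: integral0_eq => x /=; rewrite in_itv/=; exact: mean1_high.
rewrite adde0 (_ : (- S (pi / 6))%:E = (- S (-1 * (pi / 3) + pi / 2) - - S (pi /
  2))%:E)%E; last first.
  by rewrite Slog_pihalf; congr (_%:E); rewrite opprK addr0; congr (- S _);
    field.
transitivity (\int[mu]_(x in `[0%R, (pi / 3)%R]) (lcos x)%:E)%E.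
  by apply: eq_integral => x; rewrite inE/= in_itv/=; exact: mean1_low.
have dF x : 0 < x < pi / 2 -> is_derive x 1 (fun x =>
  - S (-1 * x + pi / 2)) (lcos x).
  move=> /andP[x0 x1]; rewrite -lsin_pihalfB; apply: primitive_pihalfB.
  by apply: der_Slog; apply/andP; lra.
apply: (@ge0_FTC2_oo _ _ (fun x => - S (-1 * x + pi / 2))).
- lra.
- by move=> x /andP[? ?]; apply: dF; apply/andP; lra.
- by move=> x /andP[? ?]; apply: is_derive_continuous (der_lcos _); apply/andP;
    lra.
- by move=> x /andP[? ?]; apply: ln_ge0; apply: cos_ge; rewrite !ltW.
- apply: cvgN.
  by apply: cvg_comp (is_derive_cvg_left (der_Slog (@pihalf_in R)));
    apply: affine_right_left; lra.
- exact: is_derive_cvg_left (dF _ pi3).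
Qed.

(** Three pieces: the squared logarithm gives Q(pi/2) - Q(pi/6), and the two dilogarithm averages
    give pi^3/36 - (3/2) Q(pi/3) + Q(pi/6) and pi^3/72 - (3/2) Q(pi/3) + Q(pi/2). The total uses
    Q(pi/2) = pi^3/24. *)
Lemma integral_mean2 :
  (\int[mu]_(x in `[0%R, (pi / 2)%R]) mean2 x = (pi ^+ 3 / 8 - 3 * Q (pi /
    3))%:E)%E.
Proof.
have p0 := pi_gt0 R.
rewrite (@ge0_integral_itv_split _ 0 (pi / 3)) //; last 3 first.
- by apply/andP; lra.
- exact: measurable_mean2.
- exact: mean2_ge0.
(* The reflection x to pi/2 - x turns 2 cos x into 2 sin x, which is sin x / sin(pi/6). *)
have -> : (\int[mu]_(x in `[(pi / 3)%R, (pi / 2)%R]) mean2 x =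
    \int[mu]_(x in `[0%R, (pi / 6)%R]) half_dilog (sin x / sin (pi / 6)))%E.
  rewrite (@ge0_integral_affine _ (-1) (pi / 2)) ?oppr_eq0//; last 2 first.
  - exact: measurable_mean2.
  - exact: mean2_ge0.
  rewrite normrN1 mul1e (_ : _ @^-1` _ = `[0, pi / 6]%classic); last first.
    by apply/funext => x; rewrite /= !in_itv/=; apply/propext;
      split => /andP[? ?]; apply/andP; lra.
  apply: eq_integral => x; rewrite inE/= in_itv/= => /andP[x0 x1].
  rewrite mean2_high; last by apply/andP; lra.
  rewrite (_ : -1 * x + pi / 2 = pi / 2 - x); last by ring.
  by rewrite cos_pihalfB sin_pi_div6; congr half_dilog; field.
have -> : (\int[mu]_(x in `[0%R, (pi / 3)%R]) mean2 x =
    \int[mu]_(x in `[0%R, (pi / 3)%R]) (lcos x ^+ 2)%:E +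
    \int[mu]_(x in `[0%R, (pi / 3)%R]) half_dilog (cos (pi / 3) / cos x))%E.
  rewrite -ge0_integralD//.
  - by apply: eq_integral => x; rewrite inE/= in_itv/=; exact: mean2_low.
  - by move=> x _; rewrite lee_fin sqr_ge0.
  - apply/measurable_EFinP; apply: measurable_funX; apply: measurable_funTS.
    by apply: measurableT_comp; [exact: measurable_ln|].
  - by move=> x _; exact: half_dilog_ge0.
  - apply: measurable_funTS; apply: measurable_half_dilog.
    by apply: measurable_funM => //; exact: measurable_cosV.
have -> : (\int[mu]_(x in `[0%R, (pi / 3)%R]) (lcos x ^+ 2)%:E =
    (- Q (-1 * (pi / 3) + pi / 2) - - Q (pi / 2))%:E)%E.
  have dF x : 0 < x < pi / 2 -> is_derive x 1 (fun x =>
    - Q (-1 * x + pi / 2)) (lcos x ^+ 2).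
    move=> /andP[x0 x1]; rewrite -lsin_pihalfB.
    apply: (@primitive_pihalfB Q (fun x => lsin x ^+ 2)).
    by apply: der_Qlog; apply/andP; lra.
  apply: (@ge0_FTC2_oo _ _ (fun x => - Q (-1 * x + pi / 2))).
  - lra.
  - by move=> x /andP[? ?]; apply: dF; apply/andP; lra.
  - move=> x /andP[? ?]; have c : {for x, continuous lcos}.
      by apply: is_derive_continuous (der_lcos _); apply/andP; lra.
    exact: (@cvgM R).
  - by move=> x _; exact: sqr_ge0.
  - apply: cvgN.
    by apply: cvg_comp (is_derive_cvg_left (der_Qlog (@pihalf_in R)));
      apply: affine_right_left; lra.
  - exact: is_derive_cvg_left (dF _ pi3).
rewrite integral_half_dilog_cos// integral_half_dilog_sin// -!EFinD;
  congr (_%:E).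
(* At these end points all terms containing S are multiplied by 0. *)
rewrite lcos_pi_div3 lsin_pi_div6 /KSlog !addr0.
rewrite (_ : -1 * (pi / 3) + pi / 2 = pi / 6 :> R); last by field.
rewrite (_ : -1 * (pi / 6) + pi / 2 = pi / 3 :> R); last by field.
rewrite (_ : 2 * (pi / 6) = pi / 3 :> R); last by field.
rewrite (_ : 2 * (pi / 3) = pi - pi / 3 :> R); last by field.
rewrite Qlog_piB; last by apply/andP; lra.
rewrite Qlog_pi Qlog_pihalf.
by generalize (Q (pi / 3)) (Q (pi / 6)) (pi : R) => q3 q6 p; field.
Qed.

Let der_half (F f : R -> R) x : is_derive (2^-1 * x + 0) 1 F (f (2^-1 * x + 0))
  ->
  is_derive x 1 (fun x => 2 * F (2^-1 * x + 0)) (f (x / 2)).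
Proof.
move=> h; apply: (der_eq (derM (der_cst x 2) (der_comp_affine h))).
by rewrite (_ : 2^-1 * x + 0 = x / 2); field.
Qed.

(** The substitution theta = 2t gives the factor 2. On [0, pi/3] one has 2 sin(theta/2) <= 1, so the
    logarithm is nonpositive and the minus sign of [Ls] makes the integrand nonnegative, as the
    singular form of the fundamental theorem requires. *)
Lemma Ls2_pi_div3 : Ls 2 (pi / 3 : R) = (- 2 * S (pi / 6))%:E.
Proof.
have p0 := pi_gt0 R.
have sE x : 0 <= x <= pi / 3 -> 0 <= 2 * sin (x / 2) <= 1.
  move=> /andP[x0 x1]; rewrite mulr_ge0 ?sin_ge0_pi//=; last by apply/andP; lra.
  have := x1; rewrite le_eqVlt => /predU1P[->|x2].
    by have -> : pi / 3 / 2 = pi / 6 :> R; [field|rewrite sin_pi_div6; lra].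
  have := @sin_incr _ (x / 2) (pi / 6) ltac:(lra) ltac:(lra) ltac:(lra).
  by rewrite sin_pi_div6; lra.
rewrite /Ls /oriented_integral ifT; last lra.
transitivity (- \int[mu]_(x in `[0%R, (pi / 3)%R]) - (- lsin (x / 2))%:E)%E.
  congr (- _)%E; apply: eq_integral => x; rewrite inE/= in_itv/= =>
    /sE/andP[s0 _].
  by rewrite opprK expr1 ger0_norm.
have l0 x : 0 <= x <= pi / 3 -> 0 <= - lsin (x / 2).
  by move=> /sE/andP[_ s1]; rewrite oppr_ge0 ln_le0.
rewrite integral_ge0N; last by move=> x /=; rewrite in_itv/= lee_fin; exact: l0.
rewrite oppeK -[RHS](_ : (- (2 * S (2^-1 * (pi / 3) + 0)) - - (2 * 0))%:E = _);
  last first.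
  by congr (_%:E); rewrite (_ : 2^-1 * (pi / 3) + 0 = pi / 6); [ring|field].
have dF x : 0 < x < pi -> is_derive x 1 (fun x =>
  - (2 * S (2^-1 * x + 0))) (- lsin (x / 2)).
  move=> /andP[x0 x1]; apply: derN; apply: (@der_half S (@lsin R)).
  by apply: der_Slog; apply/andP; lra.
apply: (@ge0_FTC2_oo _ _ (fun x => - (2 * S (2^-1 * x + 0)))).
- lra.
- by move=> x /andP[? ?]; apply: dF; apply/andP; lra.
- move=> x /andP[x0 x1]; have xi : 0 < x / 2 < pi by apply/andP; lra.
  have s0 : 0 < 2 * sin (x / 2) by rewrite mulr_gt0// sin_gt0_pi.
  have [d hd] : exists d, is_derive x 1 (fun x => - lsin (x / 2)) d.
    by rewrite /lsin; eexists; repeat (der_step; cbv beta).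
  exact: is_derive_continuous hd.
- by move=> x /andP[? ?]; apply: l0; apply/andP; lra.
- apply: cvgN; apply: cvgM; first exact: cvg_cst.
  by apply: cvg_comp (@Slog_cvg0 R); apply: affine_right_right; lra.
- by apply: is_derive_cvg_left (dF _ _); apply/andP; lra.
Qed.

Lemma Ls3_2pi_div3 : Ls 3 (2 * pi / 3 : R) = (- 2 * Q (pi / 3))%:E.
Proof.
have p0 := pi_gt0 R.
rewrite /Ls /oriented_integral ifT; last lra.
transitivity (- \int[mu]_(x in `[0%R, (2 * pi / 3)%R]) (lsin (x / 2) ^+
  2)%:E)%E.
  congr (- _)%E; apply: eq_integral => x; rewrite inE/= in_itv/= =>
    /andP[x0 x1].
  by rewrite ger0_norm// mulr_ge0// sin_ge0_pi//; apply/andP; lra.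
rewrite mulNr EFinN; congr (- _)%E.
rewrite -[RHS](_ : (2 * Q (2^-1 * (2 * pi / 3) + 0) - 2 * 0)%:E = _);
  last first.
  by congr (_%:E); rewrite (_ : 2^-1 * (2 * pi / 3) + 0 = pi / 3); [ring|field].
have dF x : 0 < x < pi -> is_derive x 1 (fun x =>
  2 * Q (2^-1 * x + 0)) (lsin (x / 2) ^+ 2).
  move=> /andP[x0 x1]; apply: (@der_half Q (fun x => lsin x ^+ 2)).
  by apply: der_Qlog; apply/andP; lra.
apply: (@ge0_FTC2_oo _ _ (fun x => 2 * Q (2^-1 * x + 0))).
- lra.
- by move=> x /andP[? ?]; apply: dF; apply/andP; lra.
- move=> x /andP[x0 x1]; have xi : 0 < x / 2 < pi by apply/andP; lra.
  have s0 : 0 < 2 * sin (x / 2) by rewrite mulr_gt0// sin_gt0_pi.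
  have [d hd] : exists d, is_derive x 1 (fun x => lsin (x / 2) ^+ 2) d.
    by rewrite /lsin; eexists; repeat (der_step; cbv beta).
  exact: is_derive_continuous hd.
- by move=> x _; exact: sqr_ge0.
- apply: cvgM; first exact: cvg_cst.
  by apply: cvg_comp (@Qlog_cvg0 R); apply: affine_right_right; lra.
- by apply: is_derive_cvg_left (dF _ _); apply/andP; lra.
Qed.

End mahler.

Unset Implicit Arguments.
Local Open Scope complex_scope.

Theorem theorem5 (R : realType) :
  (higher_mahler 1 (fun x y : R[i] => (1 + x + y)%R) =
    (1 / pi)%:E * Ls 2 (pi / 3 : R))%E /\
  (higher_mahler 2 (fun x y : R[i] => (1 + x + y)%R) =
    (3 / pi)%:E * Ls 3 (2 * pi / 3 : R) + (pi ^+ 2 / 4)%:E)%E.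
Proof.
have p0 := pi_gt0 R; split.
(* Both sides are -(2/pi) S(pi/6). *)
- rewrite /higher_mahler (integral_circle_fold (@measurable_mean1 R) (@mean1_ge0
    R) (@mean1_piB R)).
    rewrite integral_mean1 Ls2_pi_div3 -!EFinM; congr (_%:E).
    by generalize (pi : R) p0 (Slog (pi / 6 : R)) => p pp q; field;
      rewrite gt_eqF.
  by move=> u _ /inner1E.
(* (2/pi)(pi^3/8 - 3 Q(pi/3)) splits into pi^2/4 and (3/pi)(-2 Q(pi/3)), the latter factor being the
   log-sine value. *)
- rewrite /higher_mahler (integral_circle_fold (@measurable_mean2 R) (@mean2_ge0
    R) (@mean2_piB R)).
    rewrite integral_mean2 Ls3_2pi_div3 -!EFinM -EFinD; congr (_%:E).
    by generalize (pi : R) p0 (Qlog (pi / 3 : R)) => p pp q; field;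
      rewrite gt_eqF.
  by move=> u _ /inner2E.
Qed.
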